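(* Let $X$ be a proper geodesic $\delta$-hyperbolic space with basepoint $o$, let $\kappa$ be a sublinear function, and let $\theta>0$ be admissible for the logarithmic metric $d_{\log}=d^{X,\kappa}_{o,\theta}$. Then the natural homeomorphism $J_\theta:\partial X\to\partial_{F,\theta}X$ is bi-Lipschitz from $(\partial X,d_{\log})$ to $(\partial_{F,\theta}X,\sigma_\theta)$.
   Context: Polynomial Floyd metric. For $\theta>0$ let $g_\theta(t)=(1+t)^{-1-\theta}$, $t\ge0$. For a rectifiable path $\gamma:[0,L]\to X$ parametrized by arclength, $\operatorname{len}_\theta(\gamma)=\int_0^L g_\theta(d(o,\gamma(t)))\,dt$, and $\sigma_\theta(x,y)=\inf_\gamma\operatorname{len}_\theta(\gamma)$ over rectifiable paths in $X$ from $x$ to $y$. This is a bounded metric on $X$. Let $\overline X^{\,\theta}$ be the metric completion of $(X,\sigma_\theta)$, with the extended metric still denoted $\sigma_\theta$, and $\partial_{F,\theta}X=\overline X^{\,\theta}\setminus X$ (the polynomial Floyd boundary). The natural map $J_\theta:\partial X\to\partial_{F,\theta}X$ sends the class of a geodesic ray $\alpha$ from $o$ to the $\sigma_\theta$-limit of $\alpha(t)$ as $t\to\infty$; for $X$ proper geodesic hyperbolic it is a homeomorphism (Buckley–Kokkendorff). $A\asymp B$ means $c^{-1}B\le A\le cB$ with $c\ge1$ independent of the boundary points. Hyperbolic spaces and boundary. $(x\mid y)_p=\frac12(d(x,p)+d(y,p)-d(x,y))$. $X$ is $\delta$-hyperbolic if $(x\mid z)_p\ge\min\{(x\mid y)_p,(y\mid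 z)_p\}-\delta$ for all points. A $(q,Q)$-quasi-geodesic ($q\ge1,Q\ge0$) is a continuous map $\beta:I\to X$, $I\subseteq\mathbb R$ an interval, with $\frac1q|s-t|-Q\le d(\beta(s),\beta(t))\le q|s-t|+Q$. All quasi-geodesic rays ($I=[0,\infty)$) start at $o$. The visual boundary $\partial_\infty X$ is the set of quasi-geodesic rays from $o$ modulo finite Hausdorff distance of images; every class contains a geodesic ray. Sublinear Morse boundary. A sublinear function is $\kappa:[0,\infty)\to[1,\infty)$, increasing (non-strictly), concave, $\kappa(r)/r\to0$ as $r\to\infty$. Write $\|x\|=d(o,x)$. For closed $Z\subseteq X$, $\mathcal N_\kappa(Z,n)=\{x: d(x,Z)\le n\,\kappa(\|x\|)\}$. For a quasi-geodesic ray $\beta$ and $r>0$, $t_r=\min\{t:\|\beta(t)\|=r\}$, $\beta_r=\beta(t_r)$, $\beta|_r=\beta([0,t_r])$. A closed set $Z$ is $\kappa$-Morse if there is a proper function $m_Z:[1,\infty)\times[0,\infty)\to[0,\infty)$ such that every $(q,Q)$-quasi-geodesic segment with endpoints on $Z$ lies in $\mathcal N_\kappa(Z,m_Z(q,Q))$. $\partial_\kappa X$ is the set of quasi-geodesic rays from $o$ with $\kappa$-Morse image, modulo $\alpha\sim\beta\iff d(\alpha_r,\beta_r)/r\to0$, with the topology generated by the sets $\mathcal U_\kappa$ below. For hyperbolic $X$, sending the class of a geodesic ray from $o$ in $\partial_\infty X$ to its class in $\partial_\kappa X$ is a well-defined homeomorphism; the two boundaries are identified and denoted $\partial X$. Fellow-traveling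 radius. Fix $H(\delta,q,Q)$, depending only on $\delta,q,Q$ (Morse lemma), such that every $(q,Q)$-quasi-geodesic segment with endpoints on a geodesic lies in the $H$-neighborhood of it, and every $(q,Q)$-quasi-geodesic ray from $o$ lies in the $H$-neighborhood of any geodesic ray from $o$ representing the same boundary point. Put $M(q,Q)=\max\{q,Q,H(\delta,3q,3Q),3H(\delta,q,Q)+30\delta\}$. For a geodesic ray $\alpha_0$ from $o$ and $r>0$, $\mathcal U_\kappa(\alpha_0,r)$ is the set of boundary points $b$ such that every $(q,Q)$-quasi-geodesic ray $\beta\in b$ with $M(q,Q)<\frac{r}{24\kappa(r)}$ satisfies $\beta|_r\subseteq\mathcal N_\kappa(\alpha_0,M(q,Q))$. Fix for each boundary point a geodesic representative from $o$. For distinct $a,b$ with representatives $\alpha_0,\beta_0$, $r_o(a,b)=\min\{\sup\{r>0:a\in\mathcal U_\kappa(\beta_0,r)\},\ \sup\{r>0:b\in\mathcal U_\kappa(\alpha_0,r)\}\}$ with $\sup\emptyset=0$; $r_o(a,a)=\infty$. Logarithmic metrics (base $2$). Let $\rho(a,a)=0$; for $a\ne b$ let $\rho(a,b)=1$ if $r_o(a,b)<2$ and $\rho(a,b)=2^{-\lfloor\log_2 r_o(a,b)\rfloor+1}$ if $r_o(a,b)\ge2$. An exponent $\theta$ is admissible if $0<\theta\le 1/6$. A logarithmic metric $d_{\log}$ with exponent $\theta$ is a metric on $\partial X$ with $d_{\log}\asymp\rho^\theta$ (equivalently $\asymp(1+r_o)^{-\theta}$); such metrics exist for admissible $\theta$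 and induce the topology of $\partial X$. *)

(* Defs.v *)
From HB Require Import structures.
From mathcomp Require Import all_boot all_order all_algebra.
From mathcomp Require Import all_classical all_reals all_analysis.

Set Implicit Arguments.
Unset Strict Implicit.
Unset Printing Implicit Defensive.

Import Order.TTheory GRing.Theory Num.Theory.
Import numFieldNormedType.Exports.

Local Open Scope classical_set_scope.
Local Open Scope ring_scope.

(* Paths and rays are total functions R -> X paired with the interval on which
   they are considered; their values outside that interval are irrelevant. *)

Section HyperbolicSpaces.
Context {R : realType} {X : metricType R}.
Implicit Types (o x y z p : X) (I : set R) (Z : set X).

Definition isometric_on I (gamma : R -> X) :=
  forall s t, I s -> I t -> mdist (gamma s) (gamma t) = `|s - t|.

Definition geodesic_ray o (alpha : R -> X) :=
  alpha 0 = o /\ isometric_on `[0, +oo[ alpha.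

Definition gromov_product p x y : R :=
  (mdist x p + mdist y p - mdist x y) / 2.

Definition quasi_geodesic I (q Q : R) (beta : R -> X) :=
  [/\ is_interval I, 1 <= q, 0 <= Q, {within I, continuous beta} &
    forall s t, I s -> I t ->
      q^-1 * `|s - t| - Q <= mdist (beta s) (beta t) <= q * `|s - t| + Q].

Definition quasi_geodesic_ray o (q Q : R) (beta : R -> X) :=
  beta 0 = o /\ quasi_geodesic `[0, +oo[ q Q beta.

Definition ray_image (beta : R -> X) : set X := beta @` `[0, +oo[.

Definition neighborhood Z (h : R) : set X :=
  [set x | (edist_inf Z x <= h%:E)%E].

Definition finite_hausdorff_distance Z Z' :=
  exists D : R, Z `<=` neighborhood Z' D /\ Z' `<=` neighborhood Z D.

End HyperbolicSpaces.

Definition proper_space {R : realType} (X : metricType R) :=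
  forall (x : X) (r : R), compact [set y | mdist x y <= r].

Definition geodesic_space {R : realType} (X : metricType R) :=
  forall x y : X, exists gamma : R -> X,
    [/\ gamma 0 = x, gamma (mdist x y) = y &
        isometric_on `[0, mdist x y] gamma].

Definition hyperbolic {R : realType} (X : metricType R) (delta : R) :=
  forall p x y z : X,
    Num.min (gromov_product p x y) (gromov_product p y z) - delta
      <= gromov_product p x z.

(* The constant of the Morse lemma: it depends on delta, q and Q only, hence
   it is required to work for all spaces at once.  Two rays represent the same
   point of the visual boundary when their images are at finite Hausdorff
   distance. *)
Definition morse_constant {R : realType} (H : R -> R -> R -> R) :=
  forall (X : metricType R) (delta q Q : R),
    proper_space X -> geodesic_space X -> hyperbolic X delta ->
    (forall (I : set R) (gamma : R -> X) (a b : R) (beta : R -> X),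
       is_interval I -> isometric_on I gamma ->
       a <= b -> quasi_geodesic `[a, b] q Q beta ->
       (gamma @` I) (beta a) -> (gamma @` I) (beta b) ->
       beta @` `[a, b] `<=` neighborhood (gamma @` I) (H delta q Q)) /\
    (forall (o : X) (alpha beta : R -> X),
       geodesic_ray o alpha -> quasi_geodesic_ray o q Q beta ->
       finite_hausdorff_distance (ray_image alpha) (ray_image beta) ->
       ray_image beta `<=` neighborhood (ray_image alpha) (H delta q Q)).

Section SublinearMorseBoundary.
Context {R : realType}.

Definition sublinear (kappa : R -> R) :=
  [/\ forall r : R, 0 <= r -> 1 <= kappa r,
      {in `[0, +oo[ &, {homo kappa : r s / r <= s}},
      convex_function (`[0, +oo[%classic : set R) (fun r => - kappa r) &
      kappa r / r @[r --> +oo] --> 0].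

Context {X : metricType R} (o : X) (kappa : R -> R).

Definition kappa_neighborhood (Z : set X) (n : R) : set X :=
  [set x | (edist_inf Z x <= (n * kappa (mdist o x))%:E)%E].

(* For a quasi-geodesic ray from o the infimum is a minimum. *)
Definition hitting_time (beta : R -> X) (r : R) : R :=
  inf [set t | 0 <= t /\ mdist o (beta t) = r].

Definition hitting_point (beta : R -> X) (r : R) : X :=
  beta (hitting_time beta r).

Definition initial_part (beta : R -> X) (r : R) : set X :=
  beta @` `[0, hitting_time beta r].

(* m is proper in the sense that preimages of bounded sets are bounded. *)
Definition kappa_Morse (Z : set X) :=
  closed Z /\
  exists m : R -> R -> R,
    [/\ forall q Q : R, 1 <= q -> 0 <= Q -> 0 <= m q Q,
        forall B, exists C, forall q Q : R, 1 <= q -> 0 <= Q ->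
          m q Q <= B -> q <= C /\ Q <= C &
        forall (q Q a b : R) (beta : R -> X),
          a <= b -> quasi_geodesic `[a, b] q Q beta ->
          Z (beta a) -> Z (beta b) ->
          beta @` `[a, b] `<=` kappa_neighborhood Z (m q Q)].

Definition kappa_ray (beta : R -> X) :=
  (exists q Q, quasi_geodesic_ray o q Q beta) /\ kappa_Morse (ray_image beta).

Definition kappa_equiv (alpha beta : R -> X) :=
  mdist (hitting_point alpha r) (hitting_point beta r) / r
    @[r --> +oo] --> (0 : R).

Definition kappa_class (alpha : R -> X) : set (R -> X) :=
  [set beta | kappa_ray beta /\ kappa_equiv alpha beta].

(* A boundary point is an equivalence class of rays. *)
Definition boundary : set (set (R -> X)) := kappa_class @` kappa_ray.

Definition geodesic_representatives (rep : boundary -> R -> X) :=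
  forall a : boundary, geodesic_ray o (rep a) /\ val a (rep a).

End SublinearMorseBoundary.

Section LogarithmicMetrics.
Context {R : realType} {X : metricType R} (o : X) (kappa : R -> R).
Context (delta : R) (H : R -> R -> R -> R).
Context (rep : boundary o kappa -> R -> X).
Implicit Types a b : boundary o kappa.

Definition morse_bound (q Q : R) : R :=
  Num.max (Num.max q Q)
    (Num.max (H delta (3 * q) (3 * Q)) (3 * H delta q Q + 30 * delta)).

Definition U_kappa (alpha0 : R -> X) (r : R) : set (boundary o kappa) :=
  [set b | forall (q Q : R) (beta : R -> X),
     val b beta -> quasi_geodesic_ray o q Q beta ->
     morse_bound q Q < r / (24 * kappa r) ->
     initial_part o beta r
       `<=` kappa_neighborhood o kappa (ray_image alpha0) (morse_bound q Q)].

(* The maximum with 0 encodes the convention sup set0 = 0. *)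
Definition fellow_sup (alpha0 : R -> X) b : \bar R :=
  maxe 0%E (ereal_sup [set r%:E | r in [set r | 0 < r /\ U_kappa alpha0 r b]]).

Definition fellow_radius a b : \bar R :=
  if a == b then +oo%E
  else mine (fellow_sup (rep b) a) (fellow_sup (rep a) b).

(* fine is harmless: the fellow-traveling radius of two distinct points of the
   boundary of a hyperbolic space is finite. *)
Definition rho a b : R :=
  if a == b then 0
  else if (fellow_radius a b < 2%:E)%E then 1
  else 2 ^ (- Num.floor (ln (fine (fellow_radius a b)) / ln 2) + 1).

Definition is_metric (T : Type) (d : T -> T -> R) :=
  [/\ forall x y, 0 <= d x y, forall x y, d x y = 0 <-> x = y,
      forall x y, d x y = d y x & forall x y z, d x z <= d x y + d y z].

Definition log_metric (theta : R) (d : boundary o kappa -> boundary o kappa -> R) :=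
  is_metric d /\
  exists2 c : R, 1 <= c &
    forall a b, c^-1 * rho a b `^ theta <= d a b <= c * rho a b `^ theta.

End LogarithmicMetrics.

Definition admissible {R : realType} (theta : R) := 0 < theta <= 6^-1.

Section PolynomialFloydMetric.
Context {R : realType} {X : metricType R}.

Definition path_variation (gamma : R -> X) (a b : R) (s : seq R) : R :=
  let F := gamma \o nth b (a :: s) in
  \sum_(0 <= n < size s) mdist (F n) (F n.+1).

Definition path_length (gamma : R -> X) (a b : R) : \bar R :=
  ereal_sup [set (path_variation gamma a b s)%:E | s in itv_partition a b].

Definition arclength_path (L : R) (gamma : R -> X) :=
  [/\ 0 <= L, {within `[0, L], continuous gamma} &
    forall s t, 0 <= s -> s <= t -> t <= L ->
      path_length gamma s t = (t - s)%:E].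

Context (o : X) (theta : R).

Definition floyd_length (L : R) (gamma : R -> X) : R :=
  \int[lebesgue_measure]_(t in `[0, L])
    ((1 + mdist o (gamma t)) `^ (- 1 - theta)).

Definition floyd_metric (x y : X) : R :=
  inf [set l | exists L gamma,
    [/\ arclength_path L gamma, gamma 0 = x, gamma L = y &
        l = floyd_length L gamma]].

(* F, with the embedding i, is a metric completion of (X, d); it is unique up
   to a unique isometry compatible with the embeddings. *)
Definition metric_completion (d : X -> X -> R) (F : metricType R) (i : X -> F) :=
  [/\ forall x y, mdist (i x) (i y) = d x y,
      dense (range i) &
      forall G : set_system F, ProperFilter G -> cauchy G ->
        exists l : F, G --> l].

Context (F : metricType R) (i : X -> F).

Definition floyd_boundary : set F := ~` range i.

(* The default value i o is used only if no such limit exists. *)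
Definition floyd_map (kappa : R -> R) (a : boundary o kappa) : F :=
  xget (i o) [set l | exists2 alpha, geodesic_ray o alpha /\ val a alpha &
                        i (alpha t) @[t --> +oo] --> l].

End PolynomialFloydMetric.

(* Main.v *)
(** Both metrics are compared with [(1 + P) ^ - theta], where [P] is the supremum
    of the Gromov products [(alpha t | beta t)_o] along geodesic rays [alpha] and
    [beta] from [o] that represent the two boundary points.

    Geodesics from [o] stay [4 * delta]-close up to the radius [(x | y)_o], so
    with the Morse lemma the fellow-traveling radius lies between [P / 4] and
    [2 * P + R0].

    Upper bound for the Floyd metric: follow [alpha] down to radius [P / 2], jump
    to [beta], and go out again.

    Lower bound: cut a path into pieces of length at most 1.  If it enters the
    ball of radius [2 * P + O(1)], telescoping the tail [(1 + t) ^ - theta] along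
    the pieces suffices.  Otherwise the weight [(1 + t) ^ (- 1 - theta)] dominates
    a multiple of [exp (- e * t)] outside that ball, and Frink's chain lemma for
    the quasimetric [exp (- e * (x | y)_o)] gives a bound that does not even decay
    with [P].

    Surjectivity: a point of the completion outside [X] is the limit of an
    ultrafilter on [X] that leaves every ball, and the limits of the geodesics
    from [o] to [x] along that ultrafilter form a geodesic ray converging to it. *)
Require Import Defs.
From mathcomp Require Import all_boot all_order all_algebra.
From mathcomp Require Import all_classical all_reals all_analysis.
From mathcomp Require Import ring lra.
Import Order.TTheory GRing.Theory Num.Theory.
Import numFieldNormedType.Exports.
Local Open Scope classical_set_scope.
Local Open Scope ring_scope.

Set Implicit Arguments.
Unset Strict Implicit.
Unset Printing Implicit Defensive.


(** * Estimates for the Floyd weight and its tail *)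

Section FloydWeight.
Context {R : realType} (theta : R).
Hypothesis theta_gt0 : 0 < theta.
Hypothesis theta_le1 : theta <= 1.
Implicit Types r s t k e : R.

Definition floyd_weight t : R := (1 + t) `^ (- 1 - theta).
(** This is [theta] times the integral of [floyd_weight] over [[t, +oo[]. *)
Definition floyd_tail t : R := (1 + t) `^ (- theta).

Lemma floyd_tail_gt0 t : 0 <= t -> 0 < floyd_tail t.
Proof. by move=> t0; rewrite powR_gt0// ltr_wpDr. Qed.

Lemma floyd_weight_gt0 t : 0 <= t -> 0 < floyd_weight t.
Proof. by move=> t0; rewrite powR_gt0// ltr_wpDr. Qed.

Lemma floyd_tailE t : 0 <= t -> floyd_tail t = expR (- (theta * ln (1 + t))).
Proof. by move=> t0; rewrite /floyd_tail /powR gt_eqF ?mulNr// ltr_wpDr. Qed.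

Lemma floyd_weightE t : 0 <= t -> floyd_weight t = floyd_tail t / (1 + t).
Proof.
move=> t0; have t1 : 0 < 1 + t by rewrite ltr_wpDr.
rewrite /floyd_weight (addrC (- 1)) powRD; last by rewrite (gt_eqF t1) implybT.
by rewrite powR_inv1// ltW.
Qed.

Lemma floyd_tail_anti s t : 0 <= s -> s <= t -> floyd_tail t <= floyd_tail s.
Proof.
move=> s0 st; have t0 := le_trans s0 st.
rewrite !floyd_tailE// ler_expR lerN2 ler_pM2l// ler_ln ?posrE ?ltr_wpDr//.
by rewrite lerD2l.
Qed.

Lemma floyd_tail_le1 t : 0 <= t -> floyd_tail t <= 1.
Proof.
move=> t0; apply: (le_trans (floyd_tail_anti (lexx 0) t0)).
by rewrite /floyd_tail addr0 powR1.
Qed.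

Lemma floyd_weight_anti s t : 0 <= s -> s <= t -> floyd_weight t <= floyd_weight s.
Proof.
move=> s0 st; have t0 := le_trans s0 st.
rewrite !floyd_weightE// ler_pM ?floyd_tail_anti//.
- exact/ltW/floyd_tail_gt0.
- by rewrite invr_ge0; lra.
- by rewrite lef_pV2 ?posrE; lra.
Qed.

Lemma floyd_weight_le1 t : 0 <= t -> floyd_weight t <= 1.
Proof.
move=> t0; apply: (le_trans (floyd_weight_anti (lexx 0) t0)).
by rewrite /floyd_weight addr0 powR1.
Qed.

Lemma floyd_weight_le_tail t : 0 <= t -> floyd_weight t <= floyd_tail t.
Proof.
move=> t0; rewrite floyd_weightE// ler_pdivrMr; last lra.
by have := floyd_tail_gt0 t0; nra.
Qed.

(** The exact factor is the power [theta] of [k], which is at most [k] because [theta <= 1 <= k]. *)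
Lemma floyd_tail_scale k s t : 1 <= k -> 0 <= s -> 0 <= t ->
  1 + t <= k * (1 + s) -> floyd_tail s <= k * floyd_tail t.
Proof.
move=> k1 s0 t0 tks; have k0 : 0 < k by lra.
have -> : k * floyd_tail t = expR (ln k) * floyd_tail t by rewrite lnK ?posrE.
rewrite !floyd_tailE// -expRD ler_expR.
have : theta * ln (1 + t) <= theta * (ln k + ln (1 + s)).
  by rewrite ler_pM2l// -lnM ?ler_ln ?posrE; nra.
have lk := ln_ge0 k1; have : theta * ln k <= 1 * ln k by rewrite ler_wpM2r.
lra.
Qed.

Lemma floyd_weight_scale k s t : 1 <= k -> 0 <= s -> 0 <= t ->
  1 + t <= k * (1 + s) -> floyd_weight s <= k ^+ 2 * floyd_weight t.
Proof.
move=> k1 s0 t0 tks; rewrite !floyd_weightE//.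
have -> : k ^+ 2 * (floyd_tail t / (1 + t)) = (k * floyd_tail t) * (k / (1 + t)).
  by ring.
apply: ler_pM; first exact/ltW/floyd_tail_gt0.
- by rewrite invr_ge0; lra.
- exact: floyd_tail_scale.
- rewrite ler_pdivlMr; last lra.
  by rewrite ler_pdivrMl; lra.
Qed.

Lemma floyd_tail_ratio s t : 0 <= s -> s <= t ->
  floyd_tail t = floyd_tail s * expR (- (theta * ln ((1 + t) / (1 + s)))).
Proof.
move=> s0 st; rewrite !floyd_tailE//; last lra.
rewrite -expRD ln_div ?posrE; [|lra|lra].
by congr expR; ring.
Qed.

(** The derivative of [floyd_tail] is [- theta * floyd_weight], and the weight decreases, so its
    value at the left end bounds the slope. *)
Lemma floyd_tail_sub_le s t : 0 <= s -> s <= t ->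
  floyd_tail s - floyd_tail t <= theta * (t - s) * floyd_weight s.
Proof.
move=> s0 st; rewrite (floyd_tail_ratio s0 st) floyd_weightE//.
set y := theta * ln _; have := expR_ge1Dx (- y).
have y_le : y <= theta * ((t - s) / (1 + s)).
  rewrite /y ler_pM2l//.
  have -> : (1 + t) / (1 + s) = 1 + (t - s) / (1 + s) by field; lra.
  apply: le_ln1Dx; rewrite (lt_le_trans (ltrN10 _))// divr_ge0; lra.
have := floyd_tail_gt0 s0; set f := floyd_tail s => f0 ey.
have -> : theta * (t - s) * (f / (1 + s)) = f * (theta * ((t - s) / (1 + s))).
  by ring.
nra.
Qed.

(** Over a step of length at most 1 the ratio [v] is at most 2. Hence [ln v >= (v - 1) / 2], and
    [1 - expR (- y) >= y / 2] for [y = theta * ln v <= 1]; each estimate costs one factor 2 of the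
    4. *)
Lemma floyd_tail_sub_ge s t : 0 <= s -> s <= t -> t <= s + 1 ->
  theta / 4 * (t - s) * floyd_weight s <= floyd_tail s - floyd_tail t.
Proof.
move=> s0 st ts; rewrite (floyd_tail_ratio s0 st) floyd_weightE//.
set v := (1 + t) / (1 + s).
have v1E : (t - s) / (1 + s) = v - 1 by rewrite /v; field; lra.
have v1 : 1 <= v by rewrite /v ler_pdivlMr; lra.
have v2 : v <= 2 by rewrite /v ler_pdivrMr; lra.
have f0 := floyd_tail_gt0 s0; set f := floyd_tail s in f0 *.
have -> : theta / 4 * (t - s) * (f / (1 + s)) = f * (theta / 4 * (v - 1)).
  by rewrite -v1E; ring.
have lnv : (v - 1) / 2 <= ln v.
  have v0 : 0 < v by lra.
  have := @le_ln1Dx R (v^-1 - 1); rewrite addrCA subrr addr0 lnV ?posrE//.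
  have : 0 < v^-1 by rewrite invr_gt0.
  move=> iv /(_ ltac:(lra)) lnv.
  have : v^-1 * v = 1 by rewrite mulVf// gt_eqF.
  nra.
have lnv1 : ln v <= v - 1.
  by have := @le_ln1Dx R (v - 1); rewrite addrCA subrr addr0; apply; lra.
set y := theta * ln v.
have y0 : theta * ((v - 1) / 2) <= y by rewrite /y ler_pM2l.
have lnv0 : 0 <= ln v by lra.
have y1 : y <= 1.
  by apply: le_trans (_ : 1 * ln v <= _); rewrite ?ler_wpM2r// mul1r; lra.
have := expR_ge1Dx y; rewrite expRN.
have := expR_gt0 y; set E := expR y => E0 yE.
have EV : E^-1 * E = 1 by rewrite mulVf// gt_eqF.
have EV0 : 0 < E^-1 by rewrite invr_gt0.
have y_ge0 : 0 <= y by rewrite mulr_ge0// ltW.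
have : E^-1 <= 1 - y / 2 by rewrite -[leLHS]mul1r ler_pdivrMr//; nra.
nra.
Qed.

Lemma floyd_tail_cvg0 e : 0 < e -> exists T, forall t, T <= t -> 0 <= t -> floyd_tail t < e.
Proof.
move=> e0; exists (expR ((1 + `|ln e|) / theta)) => t Tt t0.
rewrite floyd_tailE// -[ltRHS]lnK ?posrE// ltr_expR.
have : (1 + `|ln e|) / theta <= ln (1 + t).
  rewrite -[leLHS]expRK ler_ln ?posrE ?expR_gt0//; lra.
rewrite ler_pdivrMr// => h.
have := ler_norm (- ln e); rewrite normrN; nra.
Qed.

(** The logarithmic derivative of the weight, [- (1 + theta) / (1 + t)], is at least [- 2 / (1 + r)]
    beyond [r], and this is at least [- e] once [r >= 2 / e]. *)
Lemma floyd_weight_exp e r t : 0 < e -> 2 / e <= r -> r <= t ->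
  floyd_weight r * expR (- (e * (t - r))) <= floyd_weight t.
Proof.
move=> e0 er rt; have r0 : 0 < r by rewrite (lt_le_trans _ er)// divr_gt0.
have t0 : 0 < t by lra.
rewrite /floyd_weight /powR !gt_eqF; [|lra|lra].
rewrite -expRD ler_expR.
have lnE : ln (1 + t) <= ln (1 + r) + (t - r) / (1 + r).
  rewrite -lerBlDl -ln_div ?posrE; [|lra|lra].
  have -> : (1 + t) / (1 + r) = 1 + (t - r) / (1 + r) by field; lra.
  by apply: le_ln1Dx; rewrite (lt_le_trans (ltrN10 _))// divr_ge0; lra.
have er2 : 2 <= r * e by rewrite -ler_pdivrMr.
have : (t - r) / (1 + r) * 2 <= e * (t - r).
  have -> : (t - r) / (1 + r) * 2 = (t - r) * (2 / (1 + r)) by ring.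
  rewrite [leRHS]mulrC ler_wpM2l//; first lra.
  by rewrite ler_pdivrMr; nra.
have : 0 <= (t - r) / (1 + r) by rewrite divr_ge0; lra.
set q := (t - r) / (1 + r) in lnE *; set l := ln (1 + r) in lnE *.
set m := ln (1 + t) in lnE * => q0 qe.
clearbody q l m; clear er.
have t2 : 0 <= 1 + theta by rewrite addr_ge0// ltW.
have t3 : 1 + theta <= 2 by rewrite -[2]/(1 + 1) lerD2l.
have ml : m - l <= q by rewrite lerBlDl.
have h1 := ler_wpM2l t2 ml.
have h2 : (1 + theta) * q <= 2 * q by rewrite ler_wpM2r.
have -> : (- 1 - theta) * m = (- 1 - theta) * l - (1 + theta) * (m - l) by ring.
rewrite lerD2l lerN2 (le_trans h1)// (le_trans h2)// mulrC//.
Qed.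

Lemma floyd_weight_exp_ge e : 0 < e ->
  exists2 c, 0 < c & forall r, 0 <= r -> c <= floyd_weight r * expR (e * r).
Proof.
move=> e0; pose k := 1 + 2 / e; exists (k ^+ 2)^-1.
  by rewrite invr_gt0 exprn_gt0// addr_gt0 ?divr_gt0.
have k1 : 1 <= k by rewrite lerDl divr_ge0 ?ltW.
(* Only half of the exponent is spent here, because [floyd_weight_scale] squares its factor. *)
move=> r r0; have eh := expR_ge1Dx (e * r / 2).
have E : 1 + r <= k * expR (e * r / 2) * (1 + 0).
  apply: le_trans (_ : k * (1 + e * r / 2) * (1 + 0) <= _).
    have -> : k * (1 + e * r / 2) * (1 + 0) = 1 + r + 2 / e + e * r / 2.
      by rewrite /k; field; lra.
    have : 0 <= 2 / e by rewrite divr_ge0 ?ltW.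
    have : 0 <= e * r by rewrite mulr_ge0// ltW.
    lra.
  by rewrite addr0 !mulr1 ler_pM2l//; lra.
have E1 : 1 <= k * expR (e * r / 2).
  have : 0 <= e * r by rewrite mulr_ge0// ltW.
  nra.
have := floyd_weight_scale E1 (lexx 0) r0 E.
rewrite {1}/floyd_weight addr0 powR1 exprMn -expRM_natl => h.
have k2 : 0 < k ^+ 2 by rewrite exprn_gt0//; lra.
rewrite -[leLHS]mul1r ler_pdivrMr//; apply: (le_trans h).
have -> : (2%:R * (e * r / 2)) = e * r by field.
by rewrite le_eqVlt; apply/orP; left; apply/eqP; ring.
Qed.

End FloydWeight.


(** * Paths parametrized by arclength *)

Section Paths.
Context {R : realType} {X : metricType R}.
Implicit Types (x y z o : X) (s t a b L : R) (gamma : R -> X).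

Lemma mdist_sub_le o x y : mdist o x - mdist o y <= mdist x y.
Proof. by rewrite lerBlDl [mdist x y]metric_sym metric_triangle. Qed.

Lemma mdist_dist_le o x y : `|mdist o x - mdist o y| <= mdist x y.
Proof.
rewrite ler_norml mdist_sub_le andbT lerNl opprB (metric_sym x).
exact: mdist_sub_le.
Qed.

Lemma lipschitz_within_continuous (V : metricType R) (A : set R) (f : R -> V) :
  (forall s t, A s -> A t -> mdist (f s) (f t) <= `|s - t|) ->
  {within A, continuous f}.
Proof.
move=> fl; apply/subspace_continuousP => s As.
apply/metricType_numDomainType.cvgrPdist_lt => e e0; rewrite near_withinE.
near=> t => At; apply: le_lt_trans (fl _ _ As At) _.
by near: t; apply: cvgr_dist_lt.
Unshelve. all: by end_near. Qed.

(** On an isometric path every partition has the variation of the identity, namely [t - s], so the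
    supremum runs over a single value. *)
Lemma isometric_arclength_path L gamma : 0 <= L ->
  isometric_on `[0, L] gamma -> arclength_path L gamma.
Proof.
move=> L0 gi; split=> //.
  by apply: lipschitz_within_continuous => s t As At; rewrite gi.
move=> s t s0 st tL.
have varE p : itv_partition s t p -> path_variation gamma s t p = t - s.
  move=> sp; rewrite -[t - s](@nondecreasing_variation _ s t id p) //.
  apply: eq_big_nat => k /andP[_ kp] /=.
  have mem m : (m < (size p).+1)%N -> `[0, L]%classic (nth t (s :: p) m).
    move=> mp; rewrite /= in_itv/= (le_trans s0 (itv_partition_nth_ge mp sp)).
    exact: le_trans (itv_partition_nth_le mp sp) tL.
  have /= -> := gi _ _ (mem k (ltnW kp)) (mem k.+1 kp).
  exact: distrC.
rewrite /path_length -[RHS]ereal_sup1; congr ereal_sup.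
apply/seteqP; split=> [_ [p sp <-]|_ ->] /=; first by rewrite varE.
have [st'|ts|ste] := ltgtP s t; last 1 first.
- by exists [::]; rewrite ?varE// ste; split=> //=; rewrite eqxx.
- have sp := itv_partition1 st'; exists [:: t] => //.
  by rewrite varE.
- by move: ts; rewrite ltNge st.
Qed.

Lemma arclength_path_lipschitz L gamma s t : arclength_path L gamma ->
  0 <= s -> s <= t -> t <= L -> mdist (gamma s) (gamma t) <= t - s.
Proof.
move=> [_ _ gl] s0; rewrite le_eqVlt => /predU1P[->|st] tL.
  by rewrite mdistxx subrr.
rewrite -lee_fin -(gl _ _ s0 (ltW st) tL); apply: ereal_sup_ubound.
exists [:: t]; first exact: itv_partition1.
by rewrite /path_variation big_nat1.
Qed.

Lemma arclength_path_lipschitz_norm L gamma s t : arclength_path L gamma ->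
  s \in `[0, L] -> t \in `[0, L] -> mdist (gamma s) (gamma t) <= `|s - t|.
Proof.
move=> gL; rewrite !in_itv/= => /andP[s0 sL] /andP[t0 tL].
have [st|ts] := leP s t.
  by rewrite distrC ger0_norm ?subr_ge0// (arclength_path_lipschitz gL).
rewrite metric_sym ger0_norm ?subr_ge0 ?(ltW ts)//.
by apply: (arclength_path_lipschitz gL) => //; exact: ltW.
Qed.

End Paths.

(** * Integrals over intervals and lower Riemann sums *)

Section IntegralBounds.
Context {R : realType}.
Implicit Types (f : R -> R) (a b c h : R).
Local Notation mu := (@lebesgue_measure R).

Lemma Rintegral_itv_le f a b c : a <= b ->
  mu.-integrable `[a, b] (EFin \o f) -> (forall t, t \in `[a, b] -> f t <= c) ->
  \int[mu]_(t in `[a, b]) f t <= (b - a) * c.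
Proof.
move=> ab fi fc.
have ci : mu.-integrable `[a, b] (EFin \o cst c).
  by apply: continuous_compact_integrable; [exact: segment_compact|exact: cst_continuous].
apply: le_trans (le_Rintegral _ fi ci _) _ => //.
rewrite Rintegral_cst//= lebesgue_measure_itv/= lte_fin mulrC.
by case: ltP => [//|ba]; rewrite mul0r/= (_ : b = a) ?subrr ?mul0r//;
  apply/eqP; rewrite eq_le ba ab.
Qed.

(** The interval is half open because this is what remains on the right when an integral over a
    closed interval is split at a point. *)
Lemma Rintegral_itv_ge f a b c : a <= b ->
  mu.-integrable `]a, b] (EFin \o f) -> (forall t, t \in `[a, b] -> c <= f t) ->
  (b - a) * c <= \int[mu]_(t in `]a, b]) f t.
Proof.
move=> ab fi fc.
have ci : mu.-integrable `]a, b] (EFin \o cst c).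
  apply: (@integrableS _ _ _ mu `[a, b]) => //.
    by apply: subset_itvr; rewrite bnd_simp.
  by apply: continuous_compact_integrable; [exact: segment_compact|exact: cst_continuous].
apply: le_trans (le_Rintegral _ ci fi _) => //; last first.
  by move=> t; rewrite /= in_itv/= => /andP[at_ tb]; apply: fc; rewrite in_itv/= tb ltW.
rewrite Rintegral_cst//= lebesgue_measure_itv/= lte_fin mulrC.
by case: ltP => [//|ba]; rewrite ?mul0r (_ : b = a) ?subrr ?mul0r ?mulr0//;
  apply/eqP; rewrite eq_le ba ab.
Qed.

Lemma Rintegral_itv_sum_ge f h (c : nat -> R) n : 0 <= h ->
  mu.-integrable `[0, n%:R * h] (EFin \o f) ->
  (forall i, (i < n)%N -> forall t, t \in `[i%:R * h, i.+1%:R * h] -> c i <= f t) ->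
  \sum_(i < n) h * c i <= \int[mu]_(t in `[0, n%:R * h]) f t.
Proof.
move=> h0; elim: n => [|n IH] fi fc.
  by rewrite big_ord0 mul0r set_itv1 Rintegral_set1.
have nh : n%:R * h <= n.+1%:R * h by rewrite ler_wpM2r// ler_nat.
have nh0 : 0 <= n%:R * h by rewrite mulr_ge0.
have fin : mu.-integrable `[0, n%:R * h] (EFin \o f).
  by apply: integrableS fi => //; apply: subset_itvl; rewrite bnd_simp.
have fir : mu.-integrable `]n%:R * h, n.+1%:R * h] (EFin \o f).
  by apply: integrableS fi => //; apply: subset_itvr; rewrite bnd_simp.
have := @Rintegral_itvB _ f (BLeft 0) (BRight (n.+1%:R * h)) (n%:R * h) fi.
rewrite !bnd_simp => /(_ nh0 nh) /eqP; rewrite subr_eq addrC => /eqP ->.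
rewrite big_ord_recr/= lerD//.
  by apply: IH => // i ni; apply: fc; rewrite (ltn_trans ni).
apply: le_trans (Rintegral_itv_ge nh fir (fc n _)) => //.
by rewrite -[X in _ - X]mulrC -[X in X - _]mulrC -mulrBr -natrB// subSnn mulr1.
Qed.

End IntegralBounds.

(** * Floyd length: discretization and elementary bounds *)

Section FloydLength.
Context {R : realType} {X : metricType R} (o : X) (theta : R).
Hypothesis theta_gt0 : 0 < theta.
Hypothesis theta_le1 : theta <= 1.
Local Notation mu := (@lebesgue_measure R).
Local Notation weight := (floyd_weight theta).
Local Notation tail := (floyd_tail theta).

Lemma floyd_weight_continuous t : 0 <= t -> {for t, continuous weight}.
Proof.
move=> t0; have t1 : 0 < 1 + t by rewrite ltr_wpDr.
apply: (@continuous_comp _ _ _ (fun u : R => 1 + u) (fun u => u `^ (- 1 - theta))).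
  by apply: cvgD; [exact: cvg_cst|exact: cvg_id].
apply: differentiable_continuous; apply/derivable1_diffP.
by apply: derivable_powR; rewrite in_itv/= t1.
Qed.

Lemma floyd_length_integrable L gamma : arclength_path L gamma ->
  mu.-integrable `[0, L] (EFin \o (fun t => (1 + mdist o (gamma t)) `^ (- 1 - theta))).
Proof.
move=> gL; apply: continuous_compact_integrable; first exact: segment_compact.
move=> t; apply: (@continuous_comp (subspace _) _ _ 
  (fun u => mdist o (gamma u)) weight); last first.
  exact/floyd_weight_continuous/mdist_ge0.
apply: (@lipschitz_within_continuous R R^o `[0, L]) => u v uL vL.
have := le_trans (mdist_dist_le o _ _) (arclength_path_lipschitz_norm gL uL vL).
by rewrite distrC.
Qed.

Lemma floyd_length_ge0 L gamma : 0 <= floyd_length o theta L gamma.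
Proof. by apply: Rintegral_ge0 => t _; exact: powR_ge0. Qed.

Lemma floyd_metric_le L gamma : arclength_path L gamma ->
  floyd_metric o theta (gamma 0) (gamma L) <= floyd_length o theta L gamma.
Proof.
move=> gL; apply: ge_inf; last by exists L, gamma.
by exists 0 => _ [L' [g' [_ _ _ ->]]]; exact: floyd_length_ge0.
Qed.

Lemma floyd_metric_ge x y c : geodesic_space X ->
  (forall L gamma, arclength_path L gamma -> gamma 0 = x -> gamma L = y ->
     c <= floyd_length o theta L gamma) ->
  c <= floyd_metric o theta x y.
Proof.
(* A geodesic shows that the set of lengths is nonempty; on the empty set [inf] would take a default
   value. *)
move=> geoX xyc; apply: lb_le_inf; last first.
  by move=> _ [L [g [gL g0 gLy ->]]]; exact: xyc.
have [g [g0 g1 gi]] := geoX x y.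
exists (floyd_length o theta (mdist x y) g), (mdist x y), g; split=> //.
exact: isometric_arclength_path (mdist_ge0 _ _) gi.
Qed.

Lemma floyd_metric_isometric_le L gamma m : 0 <= L -> 0 <= m ->
  isometric_on `[0, L] gamma -> (forall t, t \in `[0, L] -> m <= mdist o (gamma t)) ->
  floyd_metric o theta (gamma 0) (gamma L) <= L * weight m.
Proof.
move=> L0 m0 gi gm; have gL := isometric_arclength_path L0 gi.
apply: (le_trans (floyd_metric_le gL)).
rewrite -[L in leRHS]subr0; apply: Rintegral_itv_le => //.
  exact: floyd_length_integrable.
by move=> t tL; apply: floyd_weight_anti => //; exact: gm.
Qed.

(** Along a piece of length at most 1 the norm grows by at most 1, so [1 +] norm at most doubles,
    and [floyd_weight_scale] with [k = 2] gives the factor 4. *)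
Lemma floyd_length_sum_ge h n gamma : 0 <= h <= 1 -> arclength_path (n%:R * h) gamma ->
  \sum_(i < n) h * weight (mdist o (gamma (i%:R * h)))
    <= 4 * floyd_length o theta (n%:R * h) gamma.
Proof.
move=> /andP[h0 h1] gL; rewrite -ler_pdivrMl// mulr_sumr.
under eq_bigr do rewrite mulrCA.
apply: (@Rintegral_itv_sum_ge R _ h
  (fun i => 4^-1 * weight (mdist o (gamma (i%:R * h)))) n h0).
  exact: floyd_length_integrable.
move=> i ni t; rewrite in_itv/= => /andP[it ti].
have tn : t <= n%:R * h by rewrite (le_trans ti)// ler_wpM2r// ler_nat.
have ih0 : 0 <= i%:R * h by rewrite mulr_ge0.
rewrite ler_pdivrMl//.
have := arclength_path_lipschitz gL ih0 it tn.
have := mdist_sub_le o (gamma t) (gamma (i%:R * h)).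
rewrite (metric_sym (gamma t)).
have := mdist_ge0 o (gamma t); have := mdist_ge0 o (gamma (i%:R * h)).
move=> d0 dt0 d1 d2.
have ti' : t - i%:R * h <= 1.
  by rewrite lerBlDl (le_trans ti)// -natr1 mulrDl mul1r lerD2l.
have := @floyd_weight_scale R theta theta_gt0 theta_le1 2 _ _ _ d0 dt0.
by rewrite -natrX => wle; apply: wle; lra.
Qed.

End FloydLength.


(* Frink's lemma: split the chain at the first index where the partial sum
   reaches half of the total. *)
Lemma quasimetric_chain (R : realType) (T : Type) (q : T -> T -> R) (K : R) :
  (forall x y, 0 <= q x y) -> 1 <= K -> K * K <= 2 ->
  (forall x y z, q x z <= K * Num.max (q x y) (q y z)) ->
  forall n (x : nat -> T), (0 < n)%N ->
    q (x 0) (x n) <= 2 * \sum_(0 <= i < n) q (x i) (x i.+1).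
Proof.
move=> q0 K1 K2 qK n; elim/ltn_ind: n => n IH x n0.
pose S p := \sum_(0 <= i < p) q (x i) (x i.+1).
have S0 p : 0 <= S p by apply: sumr_ge0.
have exp : exists p, S n / 2 <= S p.+1.
  by exists n.-1; rewrite prednK// ler_pdivrMr// mulr2n mulrDr mulr1 lerDl.
case: (ex_minnP exp) => p Sp pmin.
have pn : (p < n)%N.
  have /pmin : S n / 2 <= S n.-1.+1.
    by rewrite prednK// ler_pdivrMr// mulr2n mulrDr mulr1 lerDl.
  by rewrite -(leq_add2r 1) !addn1 prednK.
have SE : S n = S p.+1 + \sum_(p.+1 <= i < n) q (x i) (x i.+1).
  by rewrite /S (@big_cat_nat _ _ _ p.+1).
have Sp1 : S p.+1 = S p + q (x p) (x p.+1) by rewrite /S big_nat_recr.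
have qp : q (x p) (x p.+1) <= S n.
  by rewrite SE Sp1 -addrA addrCA lerDl addr_ge0// sumr_ge0.
(* By minimality of [p] the first [p] steps sum to less than half of [S n], so the induction
   hypothesis bounds them by [S n]; the step from [x p] to [x p.+1] is bounded by [S n]
   trivially. *)
have head : q (x 0) (x p.+1) <= K * S n.
  have [p0|p0] := posnP p.
    by rewrite p0 in qp *; apply: (le_trans qp); rewrite ler_peMl.
  apply: (le_trans (qK _ (x p) _)); rewrite ler_wpM2l//; first lra.
  rewrite ge_max qp andbT; apply: (le_trans (IH p pn x p0)).
  rewrite -/(S p) mulrC -ler_pdivlMr// leNgt; apply/negP => /ltW.
  by have := pmin p.-1; rewrite prednK// => pp /pp; rewrite -ltnS prednK// ltnn.
change (q (x 0) (x n) <= 2 * S n).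
have [pn1|pn1] := eqVneq p.+1 n.
  by rewrite pn1 in head; apply: (le_trans head); rewrite ler_wpM2r//; nra.
have {}pn1 : (p.+1 < n)%N by rewrite ltn_neqAle pn1.
have tl : q (x p.+1) (x n) <= S n.
  have := IH (n - p.+1)%N _ (fun i => x (i + p.+1)%N).
  rewrite add0n subnK// ltn_subrL n0 /= subn_gt0 => /(_ isT pn1) h.
  apply: (le_trans h); rewrite mulrC -ler_pdivlMr//.
  have -> : \sum_(0 <= i < n - p.+1) q (x (i + p.+1)%N) (x (i.+1 + p.+1)%N) =
            \sum_(p.+1 <= i < n) q (x i) (x i.+1).
    by rewrite -[in RHS](add0n p.+1) big_addn.
  by move: Sp SE; lra.
(* Joining the head with the tail is the second use of the quasimetric inequality, so the total loss
   is [K * K <= 2]. *)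
apply: (le_trans (qK _ (x p.+1) _)).
apply: (@le_trans _ _ (K * (K * S n))).
  rewrite ler_wpM2l//; first lra.
  rewrite ge_max head (le_trans tl)// ler_peMl//.
by rewrite mulrA ler_wpM2r.
Qed.

(** * Gromov products based at [o] *)

Section GromovProduct.
Context {R : realType} {X : metricType R} (o : X).
Implicit Types x y z : X.
Local Notation norm := (mdist o).

Lemma gromov_productE x y : gromov_product o x y = (norm x + norm y - mdist x y) / 2.
Proof. by rewrite /gromov_product !(metric_sym _ o). Qed.

Lemma gromov_productC x y : gromov_product o x y = gromov_product o y x.
Proof. by rewrite !gromov_productE (metric_sym x) (addrC (norm x)). Qed.

Lemma gromov_product_ge0 x y : 0 <= gromov_product o x y.
Proof.
rewrite gromov_productE divr_ge0// subr_ge0 (metric_sym o x); exact: metric_triangle.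
Qed.

Lemma gromov_product_lel x y : gromov_product o x y <= norm x.
Proof. by rewrite gromov_productE; have := mdist_sub_le o y x; rewrite (metric_sym y); lra. Qed.

Lemma gromov_product_ge_norm x y : norm x - mdist x y <= gromov_product o x y.
Proof. by rewrite gromov_productE; have := mdist_sub_le o x y; lra. Qed.

Lemma hyperbolic_ge0 (delta : R) : hyperbolic X delta -> 0 <= delta.
Proof.
by move=> /(_ o o o o); rewrite /gromov_product mdistxx minxx; lra.
Qed.

End GromovProduct.

(** * Lower bounds for the Floyd metric *)

Section FloydLower.
Context {R : realType} {X : metricType R} (o : X) (theta delta : R).
Hypothesis theta_gt0 : 0 < theta.
Hypothesis theta_le1 : theta <= 1.
Hypothesis hypX : hyperbolic X delta.
Local Notation weight := (floyd_weight theta).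
Local Notation tail := (floyd_tail theta).
Local Notation norm := (mdist o).
Implicit Types (x : nat -> X) (h e : R) (n i : nat).

(** Outward steps do not increase the tail. An inward step increases it by at most [h] times the
    weight at the inner end, which is at most 4 times the weight at the outer end since [h <= 1]. *)
Lemma floyd_chain_telescope h n x i : h <= 1 -> (i <= n)%N ->
  (forall j, (j < n)%N -> mdist (x j) (x j.+1) <= h) ->
  tail (norm (x i)) - tail (norm (x 0)) <= 4 * \sum_(j < n) h * weight (norm (x j)).
Proof.
move=> h1 i_n xh.
have h0 : (0 < n)%N -> 0 <= h by move=> /xh; apply: le_trans; exact: mdist_ge0.
have step j : (j < n)%N ->
    tail (norm (x j.+1)) - tail (norm (x j)) <= 4 * (h * weight (norm (x j))).
  move=> jn; have hp := h0 (leq_ltn_trans (leq0n _) jn).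
  have a0 := mdist_ge0 o (x j); have b0 := mdist_ge0 o (x j.+1).
  have w0 := floyd_weight_gt0 theta a0.
  have [ab|ba] := leP (norm (x j)) (norm (x j.+1)).
    apply: (@le_trans _ _ 0).
      by rewrite subr_le0; exact: floyd_tail_anti.
    by rewrite !mulr_ge0// ltW.
  apply: le_trans (floyd_tail_sub_le theta_gt0 b0 (ltW ba)) _.
  have := mdist_sub_le o (x j) (x j.+1); have := xh j jn => d1 d2.
  have := @floyd_weight_scale R theta theta_gt0 theta_le1 2 _ _ _ b0 a0.
  rewrite -natrX => wle; have {}wle := wle ltac:(lra) ltac:(lra).
  have -> : 4 * (h * weight (norm (x j))) = h * (4 * weight (norm (x j))) by ring.
  apply: ler_pM => //; first by rewrite mulr_ge0 ?subr_ge0// ltW.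
    by rewrite ltW// floyd_weight_gt0.
  have d3 : norm (x j) - norm (x j.+1) <= h by lra.
  have d4 : 0 <= norm (x j) - norm (x j.+1) by rewrite subr_ge0 ltW.
  by apply: le_trans (_ : 1 * h <= _); [apply: ler_pM => //; exact: ltW|rewrite mul1r].
apply: (@le_trans _ _ (4 * \sum_(j < i) h * weight (norm (x j)))).
  elim: i i_n => [|i IH] i_n; first by rewrite subrr big_ord0 mulr0.
  rewrite big_ord_recr/= mulrDr.
  by have := IH (ltnW i_n); have := step i i_n; lra.
rewrite ler_wpM2l//.
have ordE m : \sum_(j < m) h * weight (norm (x j)) = \sum_(0 <= j < m) h * weight (norm (x j)).
  by rewrite big_mkord.
rewrite !ordE (@big_cat_nat _ _ _ i 0 n)//= lerDl.
rewrite big_nat_cond; apply: sumr_ge0 => j /andP[/andP[ij jn] _].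
by rewrite mulr_ge0 ?h0 ?(leq_ltn_trans _ jn)// ltW// floyd_weight_gt0// mdist_ge0.
Qed.

(** Exponentiating the hyperbolicity inequality gives a quasimetric with constant
    [K = expR (e * delta)]; the condition on [e] says exactly that [K * K <= 2]. *)
Lemma exp_gromov_product_chain e : 0 < e -> e * delta * 2 <= ln 2 ->
  forall n x, (0 < n)%N ->
    expR (- (e * gromov_product o (x 0) (x n)))
      <= 2 * \sum_(0 <= i < n) expR (- (e * gromov_product o (x i) (x i.+1))).
Proof.
move=> e0 ed; have d0 := hyperbolic_ge0 o hypX.
pose q (x y : X) := expR (- (e * gromov_product o x y)).
have q0 (x y : X) : 0 <= q x y by exact: expR_ge0.
have K1 : 1 <= expR (e * delta) by rewrite -[leLHS]expR0 ler_expR mulr_ge0// ltW.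
have K2 : expR (e * delta) * expR (e * delta) <= 2.
  by rewrite -expRD -[leRHS](@lnK _ 2) ?posrE// ler_expR; lra.
have qK (x y z : X) : q x z <= expR (e * delta) * Num.max (q x y) (q y z).
  have := hypX o x y z; rewrite /q.
  set a := gromov_product o x y; set b := gromov_product o y z => abz.
  have [ab|ba] := leP a b.
    rewrite max_l ?ler_expR ?lerN2 ?ler_pM2l// -expRD ler_expR.
    by rewrite min_l// in abz; nra.
  rewrite max_r ?ler_expR ?lerN2 ?ler_pM2l ?(ltW ba)// -expRD ler_expR.
  by rewrite min_r ?(ltW ba)// in abz; nra.
by move=> n x n0; exact: (@quasimetric_chain R X q _ q0 K1 K2 qK n x n0).
Qed.

Lemma floyd_chain_ge : exists2 c, 0 < c & forall h n x, (0 < n)%N ->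
  2^-1 <= h -> h <= 1 -> (forall j, (j < n)%N -> mdist (x j) (x j.+1) <= h) ->
  c * tail (gromov_product o (x 0) (x n)) - tail (norm (x 0))
    <= 4 * \sum_(j < n) h * weight (norm (x j)).
Proof.
have d0 := hyperbolic_ge0 o hypX.
have ln2 : 0 < ln (2 : R) by rewrite ln_gt0// ltr1n.
(* The shift [delta + 1] keeps the denominator positive when [delta = 0]. *)
pose e := ln 2 / (2 * (delta + 1)).
have e0 : 0 < e by rewrite divr_gt0//; lra.
have ed : e * delta * 2 <= ln 2.
  have -> : e * delta * 2 = ln 2 * (delta / (delta + 1)) by rewrite /e; field; lra.
  by rewrite ler_piMr ?(ltW ln2)// ler_pdivrMr; lra.
(* The exponent [e / 2] is what survives below: for the radius [r >= 2 * P] the difference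
   [e * r - e * P] is at least [e / 2 * r]. *)
have [c1 c10 wexp] := floyd_weight_exp_ge theta_gt0 theta_le1 (divr_gt0 e0 (ltr0n _ 2)).
pose k := 2 + 2 / e.
have ie0 : 0 < 2 / e by rewrite divr_gt0.
have k2 : 2 <= k by rewrite lerDl ltW.
have c2 : 0 < c1 * expR (- e) by rewrite mulr_gt0 ?expR_gt0.
exists (Num.min k^-1 (c1 * expR (- e))).
  by rewrite lt_min c2 invr_gt0 andbT; lra.
move=> h n x n0 h2 h1 xh; set c := Num.min _ _; set P := gromov_product o _ _.
have P0 : 0 <= P := gromov_product_ge0 _ _ _.
have tP : 0 < tail P := floyd_tail_gt0 _ P0.
(* The term [2 / e] meets the condition of [floyd_weight_exp], and [k] was chosen so that
   [1 + r <= k * (1 + P)]. *)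
pose r := 2 * P + 2 / e; have r0 : 0 <= r by rewrite /r; lra.
(* Either the chain enters the ball of radius [r], and telescoping from its
   start suffices, or it avoids that ball and the exponential bound applies. *)
have [[i [ni ir]]|Hr] := pselect (exists i, (i < n)%N /\ norm (x i) <= r).
  apply: le_trans (floyd_chain_telescope h1 (ltnW ni) xh).
  rewrite lerD2r (le_trans _ (floyd_tail_anti theta_gt0 (mdist_ge0 _ _) ir))//.
  apply: (@le_trans _ _ (k^-1 * tail P)).
    by rewrite ler_wpM2r ?(ltW tP)// ge_min lexx.
  rewrite ler_pdivrMl; last lra.
  apply: floyd_tail_scale => //; first lra.
  rewrite /r /k mulrDl; have : 0 <= 2 / e * P by rewrite mulr_ge0// ltW.
  lra.
have {}Hr i : (i < n)%N -> r <= norm (x i).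
  by move=> ni; rewrite leNgt; apply/negP => ri; apply: Hr; exists i; rewrite ltW.
have qw i : (i < n)%N -> weight r * expR (e * r - e) *
    expR (- (e * gromov_product o (x i) (x i.+1))) <= weight (norm (x i)).
  move=> ni; have er : 2 / e <= r by rewrite /r; lra.
  apply: le_trans (floyd_weight_exp theta_gt0 theta_le1 e0 er (Hr i ni)).
  rewrite -mulrA -expRD ler_wpM2l ?ler_expR//; first by rewrite ltW// floyd_weight_gt0.
  have := gromov_product_ge_norm o (x i) (x i.+1); have := xh i ni => d1 d2.
  have : e * (norm (x i) - 1) <= e * gromov_product o (x i) (x i.+1).
    by rewrite ler_pM2l//; lra.
  lra.
have Sw : expR (- (e * P)) * (weight r * expR (e * r - e)) <= 2 * \sum_(j < n) weight (norm (x j)).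
  rewrite mulrC; apply: (@le_trans _ _ (weight r * expR (e * r - e) *
     (2 * \sum_(0 <= i < n) expR (- (e * gromov_product o (x i) (x i.+1)))))).
    rewrite ler_pM2l ?exp_gromov_product_chain// mulr_gt0 ?expR_gt0 ?floyd_weight_gt0//.
  rewrite mulrCA ler_wpM2l// mulr_sumr big_mkord; apply: ler_sum => i _.
  exact: qw.
have wr : c1 * expR (- e) <= expR (- (e * P)) * (weight r * expR (e * r - e)).
  have -> : expR (- (e * P)) * (weight r * expR (e * r - e)) =
     weight r * expR (e * r - e * P) * expR (- e).
    rewrite mulrCA -!mulrA -!expRD; congr (_ * expR _); ring.
  rewrite ler_wpM2r ?expR_ge0// (le_trans (wexp r r0))//.
  rewrite ler_wpM2l ?ler_expR//; first by rewrite ltW// floyd_weight_gt0.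
  have -> : e * r - e * P = e / 2 * r + e * (r / 2 - P) by field.
  rewrite lerDl mulr_ge0 ?(ltW e0)// /r; lra.
(* The bound outside the ball is a constant, so [tail P <= 1] is all that is asked of the tail. *)
have t1 : c * tail P <= c1 * expR (- e).
  apply: le_trans (_ : c * 1 <= _).
    rewrite ler_wpM2l ?floyd_tail_le1//.
    by rewrite le_min (ltW c2) invr_ge0 andbT; lra.
  by rewrite mulr1 ge_min lexx orbT.
have S0 : 0 <= \sum_(j < n) weight (norm (x j)).
  by apply: sumr_ge0 => j _; rewrite ltW// floyd_weight_gt0// mdist_ge0.
rewrite -mulr_sumr; have := floyd_tail_gt0 theta (mdist_ge0 o (x 0)).
(* The lower bound on [h] turns a bound on the plain sum of weights into one on the Riemann sum. *)
have : 2^-1 * \sum_(j < n) weight (norm (x j)) <= h * \sum_(j < n) weight (norm (x j)).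
  by rewrite ler_wpM2r.
move: Sw wr t1; lra.
Qed.

Lemma arclength_path_chain L (gamma : R -> X) : arclength_path L gamma ->
  exists h n, [/\ (0 < n)%N, n%:R * h = L, 0 <= h <= 1, 1 <= L -> 2^-1 <= h &
    forall j, (j < n)%N -> mdist (gamma (j%:R * h)) (gamma (j.+1%:R * h)) <= h].
Proof.
move=> gL; have [L0 _ _] := gL.
(* With [L < n <= L + 1] the step [L / n] is below 1, and it is at least [2^-1] as soon as [L >= 1].
   The successor keeps the chain nonempty when [L = 0]. *)
pose n := (Num.truncn L).+1; have n0 : 0 < n%:R :> R by rewrite ltr0n.
have Ln : L < n%:R by rewrite truncnS_gt.
have nL : n%:R <= L + 1 by rewrite -natr1 lerD2r truncn_le.
pose h := L / n%:R; have nh : n%:R * h = L by rewrite mulrC divfK// gt_eqF.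
have h0 : 0 <= h by rewrite divr_ge0// ltW.
exists h, n; split=> //.
- by rewrite h0 ler_pdivrMr// mul1r ltW.
- by move=> L1; rewrite ler_pdivlMr// ler_pdivrMl//; lra.
- move=> j jn; have := @arclength_path_lipschitz _ _ L gamma (j%:R * h) (j.+1%:R * h) gL.
  have -> : j.+1%:R * h - j%:R * h = h by rewrite -natr1; ring.
  apply; first by rewrite mulr_ge0.
    by rewrite ler_wpM2r// ler_nat.
  by rewrite -nh ler_wpM2r// ler_nat.
Qed.

(** The factor 16 is 4 from telescoping times 4 from sampling the path. With [x] running to infinity
    along a ray, the bound keeps the limit of the ray away from the points of [X]. *)
Lemma floyd_metric_ge_tail_sub (geoX : geodesic_space X) (x y : X) :
  tail (norm y) - tail (norm x) <= 16 * floyd_metric o theta x y.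
Proof.
rewrite -ler_pdivrMl//; apply: floyd_metric_ge => // L g gL gx gy.
have [h [n [n0 nh /andP[h0 h1] _ xh]]] := arclength_path_chain gL.
have := @floyd_chain_telescope h n (fun j => g (j%:R * h)) n h1 (leqnn n) xh.
rewrite nh mul0r gx gy => tl; rewrite -nh in gL.
have := floyd_length_sum_ge o theta_gt0 theta_le1 (introT andP (conj h0 h1)) gL.
rewrite nh ler_pdivrMl// => sl; lra.
Qed.

Lemma floyd_metric_ge_gromov_product : geodesic_space X -> exists2 c, 0 < c &
  forall x y : X, 1 <= mdist x y ->
    c * tail (gromov_product o x y) - tail (norm x) <= 16 * floyd_metric o theta x y.
Proof.
move=> geoX; have [c c0 cH] := floyd_chain_ge; exists c => // x y xy1.
rewrite -ler_pdivrMl//; apply: floyd_metric_ge => // L g gL gx gy.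
(* The distance condition serves to make the path long enough for the steps of its chain to be at
   least [2^-1]. *)
have L1 : 1 <= L.
  have [L0 _ _] := gL; apply: (le_trans xy1).
  by rewrite -gx -gy -[leRHS]subr0; exact: (arclength_path_lipschitz gL).
have [h [n [n0 nh /andP[h0 h1] /(_ L1) h2 xh]]] := arclength_path_chain gL.
have := cH h n (fun j => g (j%:R * h)) n0 h2 h1 xh.
rewrite nh mul0r gx gy => tl; rewrite -nh in gL.
have := floyd_length_sum_ge o theta_gt0 theta_le1 (introT andP (conj h0 h1)) gL.
rewrite nh ler_pdivrMl// => sl; lra.
Qed.

End FloydLower.


(** * Upper bounds for the Floyd metric *)

Section FloydUpper.
Context {R : realType} {X : metricType R} (o : X) (theta : R).
Hypothesis theta_gt0 : 0 < theta.
Hypothesis theta_le1 : theta <= 1.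
Local Notation weight := (floyd_weight theta).
Local Notation tail := (floyd_tail theta).
Local Notation norm := (mdist o).
Local Notation sigma := (floyd_metric o theta).

(** A geodesic of length [d] from [x] stays at norm at least [norm x - d]; moving the tail from
    there to [norm x] costs a factor [1 + d]. *)
Lemma floyd_metric_le_mdist_tail (x y : X) : geodesic_space X ->
  sigma x y <= mdist x y * ((1 + mdist x y) * tail (norm x)).
Proof.
move=> /(_ x y)[g [g0 g1 gi]]; set d := mdist x y in g1 gi *.
have d0 : 0 <= d := mdist_ge0 _ _.
pose m := Num.max 0 (norm x - d).
have m0 : 0 <= m by rewrite le_max lexx.
have gm t : t \in `[0, d] -> m <= norm (g t).
  rewrite in_itv/= => /andP[t0 td]; rewrite ge_max mdist_ge0/=.
  have := gi 0 t; rewrite /= !in_itv/= lexx d0 t0 td => /(_ isT isT).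
  rewrite g0 sub0r normrN ger0_norm//.
  by have := mdist_sub_le o x (g t); lra.
have := floyd_metric_isometric_le theta_gt0 d0 m0 gi gm.
rewrite g0 g1 => /le_trans -> //; rewrite ler_wpM2l//.
apply: le_trans (floyd_weight_le_tail theta m0) _.
apply: floyd_tail_scale => //; [lra|exact: mdist_ge0|].
have : norm x - d <= m by rewrite le_max lexx orbT.
by have := mulr_ge0 d0 m0; nra.
Qed.

Lemma floyd_metric_le_mdist (x y : X) : geodesic_space X -> sigma x y <= mdist x y.
Proof.
move=> /(_ x y)[g [g0 g1 gi]].
have := floyd_metric_isometric_le theta_gt0 (mdist_ge0 x y) (lexx 0) gi
  (fun t _ => mdist_ge0 o (g t)).
rewrite g0 g1 => /le_trans; apply.
by rewrite ler_piMr ?mdist_ge0// floyd_weight_le1.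
Qed.

(** On pieces of length at most 1, [floyd_tail_sub_ge] bounds the Floyd length by the drop of the
    tail, and the drops telescope. The metric axioms assumed for [sigma] are later read off from the
    completion, where [sigma] becomes [mdist]. *)
Lemma floyd_metric_radial D (g : R -> X) s t :
  (forall x y z, sigma x z <= sigma x y + sigma y z) -> (forall x, sigma x x = 0) ->
  g 0 = o -> isometric_on `[0, D] g -> 0 <= s -> s <= t -> t <= D ->
  sigma (g s) (g t) <= 4 / theta * (tail s - tail t).
Proof.
move=> tri sxx g0 gi s0 st tD.
have normg u : 0 <= u -> u <= D -> norm (g u) = u.
  move=> u0 uD; rewrite -g0 gi ?sub0r ?normrN ?ger0_norm//= in_itv/= ?u0// lexx.
  exact: le_trans uD.
have short u v : 0 <= u -> u <= v -> v <= u + 1 -> v <= D ->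
    sigma (g u) (g v) <= 4 / theta * (tail u - tail v).
  move=> u0 uv vu vD.
  have guv : isometric_on `[0, v - u] (fun w => g (u + w)).
    move=> w w'; rewrite /= !in_itv/= => /andP[w0 wv] /andP[w0' wv'].
    rewrite gi/= ?in_itv/=; [|lra|lra].
    by congr `|_|; ring.
  have gm w : w \in `[0, v - u] -> u <= norm (g (u + w)).
    by rewrite in_itv/= => /andP[w0 wv]; rewrite normg; lra.
  have uv0 : 0 <= v - u by rewrite subr_ge0.
  have := floyd_metric_isometric_le theta_gt0 uv0 u0 guv gm.
  rewrite addr0 (addrC u) subrK => /le_trans; apply.
  have := floyd_tail_sub_ge theta_gt0 theta_le1 u0 uv vu.
  rewrite mulrAC -mulrA => h.
  have -> : (v - u) * weight u = 4 / theta * (theta / 4 * (weight u * (v - u))).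
    by field; rewrite gt_eqF.
  rewrite ler_wpM2l ?divr_ge0 ?(ltW theta_gt0)//.
have long n : forall u, s <= u -> u <= t -> t <= u + n%:R ->
    sigma (g u) (g t) <= 4 / theta * (tail u - tail t).
  elim: n => [|n IH] u su ut.
    rewrite addr0 => tu; have -> : u = t by apply/eqP; rewrite eq_le ut tu.
    by rewrite sxx subrr mulr0.
  rewrite -natr1 => tu.
  have [t1|t1] := leP t (u + 1).
    by apply: short => //; lra.
  apply: le_trans (tri _ (g (u + 1)) _) _.
  have h1 := IH (u + 1) ltac:(lra) (ltW t1) ltac:(lra).
  have h2 := short u (u + 1) ltac:(lra) ltac:(lra) ltac:(lra) ltac:(lra).
  have -> : 4 / theta * (tail u - tail t) = 4 / theta * (tail u - tail (u + 1)) +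
    4 / theta * (tail (u + 1) - tail t) by ring.
  exact: lerD.
apply: (long (Num.truncn (t - s)).+1) => //.
by rewrite -lerBlDl ltW// truncnS_gt.
Qed.

End FloydUpper.

(** * Geodesic rays and sublinear equivalence *)

Section Rays.
Context {R : realType} {X : metricType R} (o : X).
Local Notation norm := (mdist o).
Implicit Types (alpha beta g : R -> X) (s t r : R).

Lemma geodesic_ray_norm alpha t : geodesic_ray o alpha -> 0 <= t -> norm (alpha t) = t.
Proof.
move=> [a0 ai] t0; rewrite -a0 ai ?sub0r ?normrN ?ger0_norm//= in_itv/= ?t0// lexx//.
Qed.

Lemma geodesic_ray_isometric alpha D : geodesic_ray o alpha -> isometric_on `[0, D] alpha.
Proof.
move=> [_ ai] s t; rewrite /= !in_itv/= => /andP[s0 _] /andP[t0 _].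
by apply: ai; rewrite /= in_itv/= ?s0 ?t0.
Qed.

(** In the chain [alpha s], [alpha D], [beta D'], [beta s] consecutive Gromov products are at least
    [s]. Two uses of hyperbolicity lose [2 * delta], and both ends have norm [s], so their distance
    is at most twice that loss. *)
Lemma geodesics_close delta D D' alpha beta s : hyperbolic X delta ->
  0 <= D -> 0 <= D' -> alpha 0 = o -> beta 0 = o ->
  isometric_on `[0, D] alpha -> isometric_on `[0, D'] beta ->
  0 <= s -> s <= gromov_product o (alpha D) (beta D') ->
  mdist (alpha s) (beta s) <= 4 * delta.
Proof.
move=> hypX D0 D0' a0 b0 ai bi s0 sg.
have na u : 0 <= u -> u <= D -> norm (alpha u) = u.
  by move=> u0 uD; rewrite -a0 ai ?sub0r ?normrN ?ger0_norm//= in_itv/= ?u0// lexx.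
have nb u : 0 <= u -> u <= D' -> norm (beta u) = u.
  by move=> u0 uD; rewrite -b0 bi ?sub0r ?normrN ?ger0_norm//= in_itv/= ?u0// lexx.
have sD : s <= D by rewrite (le_trans sg)// (le_trans (gromov_product_lel _ _ _))// na.
have sD' : s <= D'.
  by rewrite (le_trans sg)// gromov_productC (le_trans (gromov_product_lel _ _ _))// nb.
have ga : gromov_product o (alpha s) (alpha D) = s.
  rewrite gromov_productE !na// ai//= ?in_itv/= ?s0 ?sD ?D0 ?lexx//.
  by rewrite distrC ger0_norm; lra.
have gb : gromov_product o (beta D') (beta s) = s.
  rewrite gromov_productE !nb// bi//= ?in_itv/= ?s0 ?sD' ?D0' ?lexx//.
  by rewrite ger0_norm; lra.
have h1 := hypX o (alpha s) (alpha D) (beta s).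
have h2 := hypX o (alpha D) (beta D') (beta s).
rewrite gb min_r// in h2; rewrite ga in h1.
have d0 := hyperbolic_ge0 o hypX.
have : s - 2 * delta <= gromov_product o (alpha s) (beta s).
  apply: le_trans h1; have : s - delta <= Num.min s (gromov_product o (alpha D) (beta s)).
    by rewrite le_min h2 andbT; lra.
  lra.
by rewrite gromov_productE na// nb//; lra.
Qed.

Lemma geodesic_rays_close delta alpha beta s t : hyperbolic X delta ->
  geodesic_ray o alpha -> geodesic_ray o beta -> 0 <= t ->
  0 <= s -> s <= gromov_product o (alpha t) (beta t) ->
  mdist (alpha s) (beta s) <= 4 * delta.
Proof.
move=> hypX ga gb t0; have [[a0 _] [b0 _]] := (ga, gb).
by apply: geodesics_close => //; exact: geodesic_ray_isometric.
Qed.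

Lemma gromov_product_rays alpha beta t : geodesic_ray o alpha -> geodesic_ray o beta ->
  0 <= t -> gromov_product o (alpha t) (beta t) = t - mdist (alpha t) (beta t) / 2.
Proof. by move=> ga gb t0; rewrite gromov_productE !geodesic_ray_norm//; field. Qed.

Lemma hitting_time_geodesic alpha r : geodesic_ray o alpha -> 0 <= r ->
  hitting_time o alpha r = r.
Proof.
move=> ga r0; rewrite /hitting_time -[RHS]inf1; congr inf.
apply/seteqP; split=> t /=; first by move=> [t0]; rewrite geodesic_ray_norm.
by move=> ->; rewrite geodesic_ray_norm.
Qed.

Lemma hitting_point_geodesic alpha r : geodesic_ray o alpha -> 0 <= r ->
  hitting_point o alpha r = alpha r.
Proof. by move=> ga r0; rewrite /hitting_point hitting_time_geodesic. Qed.

Lemma kappa_equiv_sym alpha beta : kappa_equiv o alpha beta -> kappa_equiv o beta alpha.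
Proof. by rewrite /kappa_equiv; under eq_fun do rewrite metric_sym. Qed.

Lemma kappa_equivP alpha beta : kappa_equiv o alpha beta <->
  forall e, 0 < e -> exists T, forall r, T < r ->
    mdist (hitting_point o alpha r) (hitting_point o beta r) < e * r.
Proof.
split=> [/cvgrPdist_lt ab e e0|ab].
  have [T [_ HT]] := ab e e0; exists (Num.max 0 T) => r; rewrite gt_max => /andP[r0 Tr].
  have := HT r Tr; rewrite sub0r normrN ger0_norm ?divr_ge0 ?mdist_ge0 ?(ltW r0)//.
  by rewrite ltr_pdivrMr.
apply/cvgrPdist_lt => e e0; have [T HT] := ab e e0.
near=> r; have r0 : 0 < r by near: r; exact: nbhs_pinfty_gt.
rewrite sub0r normrN ger0_norm ?divr_ge0 ?mdist_ge0 ?(ltW r0)// ltr_pdivrMr//.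
by apply: HT; near: r; apply: nbhs_pinfty_gt; exact: num_real.
Unshelve. all: by end_near. Qed.

Lemma kappa_equiv_trans alpha beta g :
  kappa_equiv o alpha beta -> kappa_equiv o beta g -> kappa_equiv o alpha g.
Proof.
move=> /kappa_equivP ab /kappa_equivP bg; apply/kappa_equivP => e e0.
have e20 : 0 < e / 2 by rewrite divr_gt0.
have [T1 h1] := ab _ e20; have [T2 h2] := bg _ e20.
exists (Num.max T1 T2) => r; rewrite gt_max => /andP[/h1 r1 /h2 r2].
apply: le_lt_trans (metric_triangle _ (hitting_point o beta r) _) _.
have -> : e * r = e / 2 * r + e / 2 * r by field.
exact: ltrD.
Qed.

Lemma kappa_equiv_bounded C alpha beta : geodesic_ray o alpha -> geodesic_ray o beta ->
  (forall s, 0 <= s -> mdist (alpha s) (beta s) <= C) -> kappa_equiv o alpha beta.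
Proof.
move=> ga gb abC; apply/kappa_equivP => e e0.
exists (Num.max 0 (C / e)) => r; rewrite gt_max => /andP[r0 Cr].
rewrite !hitting_point_geodesic ?(ltW r0)//.
apply: le_lt_trans (abC _ (ltW r0)) _.
by rewrite mulrC -ltr_pdivrMr.
Qed.

(** One large radius [r] at which the rays are less than [r] apart suffices: the Gromov product
    there exceeds [r / 2 >= s]. *)
Lemma kappa_equiv_close delta alpha beta : hyperbolic X delta ->
  geodesic_ray o alpha -> geodesic_ray o beta -> kappa_equiv o alpha beta ->
  forall s, 0 <= s -> mdist (alpha s) (beta s) <= 4 * delta.
Proof.
move=> hypX ga gb /kappa_equivP /(_ _ ltr01)[T HT] s s0.
pose r := Num.max 0 T + 2 * s + 1.
have m0 : 0 <= Num.max 0 T by rewrite le_max lexx.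
have mT : T <= Num.max 0 T by rewrite le_max lexx orbT.
have r0 : 0 <= r by rewrite /r; lra.
have := HT r; rewrite !hitting_point_geodesic// => /(_ ltac:(rewrite /r; lra)) dr.
apply: (geodesic_rays_close hypX ga gb r0 s0).
by rewrite gromov_product_rays//; move: dr; rewrite /r; lra.
Qed.

End Rays.

(** * Boundary points as equivalence classes of rays *)

Section BoundaryPoints.
Context {R : realType} {X : metricType R} (o : X) (kappa : R -> R).
Implicit Types (a b : boundary o kappa) (alpha beta : R -> X).

Lemma boundary_equiv a alpha beta : val a alpha -> val a beta -> kappa_equiv o alpha beta.
Proof.
case: a => A /=; rewrite inE => -[g _ <-] [_ ga] [_ gb].
exact: kappa_equiv_trans (kappa_equiv_sym ga) gb.
Qed.

Lemma boundary_eq a b alpha beta : val a alpha -> val b beta ->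
  kappa_equiv o alpha beta -> a = b.
Proof.
move=> aa bb ab; apply: val_inj.
case: a b aa bb => A + [B]; rewrite /= !inE => -[g _ <-] [g' _ <-] [_ ga] [_ gb].
have gg : kappa_equiv o g g'.
  exact: kappa_equiv_trans (kappa_equiv_trans ga ab) (kappa_equiv_sym gb).
apply/seteqP; split=> u [ur gu]; split=> //.
  exact: kappa_equiv_trans (kappa_equiv_sym gg) gu.
exact: kappa_equiv_trans gg gu.
Qed.

Lemma boundary_of_ray alpha : kappa_ray o kappa alpha ->
  exists a, val a alpha.
Proof.
move=> ar; have aB : kappa_class o kappa alpha \in boundary o kappa by rewrite inE; exists alpha.
exists (SigSub aB); split=> //; apply/kappa_equivP => e e0; exists 0 => r r0.
by rewrite mdistxx mulr_gt0.
Qed.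

End BoundaryPoints.


(** * Distance to a set *)

Section DistanceToSet.
Context {R : realType} {X : metricType R}.
Implicit Types (Z : set X) (x z : X) (h : R).

Lemma mdist_continuous (o : X) : continuous (mdist o : X -> R).
Proof.
move=> x; apply/cvgrPdist_lt => e e0; near=> y.
apply: le_lt_trans (mdist_dist_le _ _ _) _.
by near: y; apply: metricType_numDomainType.cvgr_dist_lt => //; exact: cvg_id.
Unshelve. all: by end_near. Qed.

Lemma edist_inf_lt_mdist Z x h : (edist_inf Z x < h%:E)%E ->
  exists2 z, Z z & mdist x z < h.
Proof.
move=> /ereal_inf_lt[_ [z Zz <-]] /edist_lt_ball; rewrite ballEmdist => xz.
by exists z.
Qed.

Lemma edist_inf_le_mdist Z x z h : Z z -> mdist x z < h -> (edist_inf Z x <= h%:E)%E.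
Proof.
move=> Zz xz; apply: (@le_trans _ _ (edist (x, z))).
  by apply: ereal_inf_lbound; exists z.
apply: edist_fin; first exact: le_lt_trans (mdist_ge0 _ _) xz.
by rewrite ballEmdist.
Qed.

End DistanceToSet.

(** * Hitting times and the Morse lemma for quasi-geodesic rays *)

Section QuasiGeodesicRays.
Context {R : realType} {X : metricType R} (o : X).
Local Notation norm := (mdist o).
Implicit Types (alpha beta g : R -> X) (s t r q Q : R).

Lemma quasi_geodesic_ray_ivt q Q beta t r : quasi_geodesic_ray o q Q beta ->
  0 <= t -> 0 <= r -> r <= norm (beta t) ->
  exists2 u, 0 <= u <= t & norm (beta u) = r.
Proof.
move=> [b0 [_ _ _ bc _]] t0 r0 rt.
have nc : {within `[0, t], continuous (norm \o beta)}.
  move=> u; apply: (@continuous_comp (subspace _) _ _ beta norm); last exact: mdist_continuous.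
  apply: (continuous_subspaceW _ bc).
  by apply: subset_itvl; rewrite bnd_simp.
have [|u] := IVT t0 nc (v := r).
  rewrite /= b0 mdistxx min_l ?mdist_ge0// max_r ?mdist_ge0// r0//.
by rewrite in_itv/= => u0 ur; exists u.
Qed.

Lemma hitting_time_has_inf q Q beta t r : quasi_geodesic_ray o q Q beta ->
  0 <= t -> 0 <= r -> r <= norm (beta t) ->
  has_inf [set u | 0 <= u /\ norm (beta u) = r].
Proof.
move=> bq t0 r0 rt; split; last by exists 0 => u [].
have [u /andP[u0 _] ur] := quasi_geodesic_ray_ivt bq t0 r0 rt.
by exists u.
Qed.

(** By the intermediate value theorem, norm above [r] at time [t] yields a visit to the sphere of
    radius [r] by time [t], which must then be [t] itself. *)
Lemma norm_le_before_hitting q Q beta t r : quasi_geodesic_ray o q Q beta ->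
  0 <= r -> 0 <= t -> t <= hitting_time o beta r -> norm (beta t) <= r.
Proof.
move=> bq r0 t0 th; rewrite leNgt; apply/negP => rt.
have [u /andP[u0 ut] ur] := quasi_geodesic_ray_ivt bq t0 r0 (ltW rt).
have hu : hitting_time o beta r <= u.
  by apply: ge_inf => //; exists 0 => ? [].
have utE : u = t by apply/eqP; rewrite eq_le ut (le_trans th hu).
by rewrite -utE ur ltxx in rt.
Qed.

(** Visits to the sphere accumulate at their infimum from the right, so continuity puts the infimum
    on the sphere too. *)
Lemma hitting_time_attained q Q beta t r : quasi_geodesic_ray o q Q beta ->
  0 <= t -> 0 <= r -> r <= norm (beta t) ->
  0 <= hitting_time o beta r /\ norm (hitting_point o beta r) = r.
Proof.
move=> bq t0 r0 rt; have hi := hitting_time_has_inf bq t0 r0 rt.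
set S := [set _ | _] in hi; have [Sn Sb] := hi.
have tau0 : 0 <= inf S by apply: lb_le_inf => // u [].
split=> //; rewrite /hitting_point /hitting_time -/S.
have [b0 [_ _ _ bc _]] := bq.
apply/eqP; rewrite -subr_eq0 -normr_le0; apply/ler_addgt0Pl => e e0; rewrite addr0.
have tauI : `[0, +oo[%classic (inf S) by rewrite /= in_itv/= tau0.
have /subspace_continuousP/(_ _ tauI) := bc.
move=> /metricType_numDomainType.cvgr_dist_lt /(_ e e0).
rewrite near_withinE => /nbhs_ballP[d /= d0 Hd].
have [u [u0 ur] ud] := inf_adherent d0 hi.
have uS : inf S <= u by apply: ge_inf.
have := Hd u; rewrite /ball/= => /(_ _ _)/ltW; rewrite -ur => h.
apply: le_trans (mdist_dist_le _ _ _) (h _ _).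
  by rewrite distrC ger0_norm ?subr_ge0// ltrBlDl.
by rewrite in_itv/= u0.
Qed.

Lemma quasi_geodesic_ray_norm_le q Q beta t : quasi_geodesic_ray o q Q beta ->
  0 <= t -> norm (beta t) <= q * t + Q.
Proof.
move=> [b0 [_ _ _ _ /(_ 0 t)]] + t0; rewrite /= !in_itv/= lexx t0 => /(_ isT isT)/andP[_].
by rewrite b0 sub0r normrN ger0_norm.
Qed.

Lemma quasi_geodesic_ray_unbounded q Q beta r : quasi_geodesic_ray o q Q beta ->
  exists2 t, 0 <= t & r <= norm (beta t).
Proof.
move=> [b0 [_ q1 Q0 _ bq]]; exists (q * (`|r| + Q)).
  by rewrite mulr_ge0 ?addr_ge0//; lra.
have h0 : 0 <= q * (`|r| + Q) by rewrite mulr_ge0 ?addr_ge0//; lra.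
have := bq 0 (q * (`|r| + Q)); rewrite /= !in_itv/= lexx h0 => /(_ isT isT)/andP[+ _].
rewrite b0 sub0r normrN ger0_norm// mulKf; last by rewrite gt_eqF//; lra.
by have := ler_norm r; lra.
Qed.

(* Apply the Morse lemma to [beta] up to its first point on a very large sphere:
   [kappa_equiv] only makes that point sublinearly close to [alpha], but then
   the geodesic from [o] to it is close to [alpha] at bounded radius. *)
Lemma quasi_geodesic_ray_near_geodesic (H : R -> R -> R -> R) delta q Q beta alpha t :
  proper_space X -> geodesic_space X -> hyperbolic X delta -> morse_constant H ->
  geodesic_ray o alpha -> quasi_geodesic_ray o q Q beta -> kappa_equiv o beta alpha ->
  0 <= t -> exists s, [/\ 0 <= s, s <= norm (beta t) + H delta q Q + 2^-1 &
    mdist (beta t) (alpha s) < H delta q Q + 2^-1 + 4 * delta].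
Proof.
move=> propX geoX hypX morse ga bq /kappa_equivP /(_ _ ltr01)[T0 HT] t0.
set h := H delta q Q.
have [b0 [_ q1 Q0 bc bqq]] := bq.
have qt : 0 <= q * t + Q by rewrite addr_ge0// mulr_ge0//; lra.
have nt := quasi_geodesic_ray_norm_le bq t0.
(* The term [q * t + Q] forces the hitting time beyond [t], the next one gives [2 * s <= r] for the
   nearby parameter [s], and [T0] makes the sublinear bound available at [r]. *)
pose r := q * t + Q + 2 * `|norm (beta t) + h + 2^-1| + `|T0| + 1.
have r0 : 0 < r.
  rewrite /r; have := normr_ge0 (norm (beta t) + h + 2^-1).
  by have := normr_ge0 T0; lra.
have [tr tr0 rtr] := quasi_geodesic_ray_unbounded r bq.
have [T_0 nT] := hitting_time_attained bq tr0 (ltW r0) rtr.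
set T := hitting_time o beta r in T_0.
have rT : mdist (beta T) (alpha r) < r.
  have := HT r; rewrite (hitting_point_geodesic ga (ltW r0)) mul1r; apply.
  by rewrite /r; have := normr_ge0 (norm (beta t) + h + 2^-1); have := ler_norm T0; lra.
have tT : t <= T.
  rewrite leNgt; apply/negP => Tt.
  have := quasi_geodesic_ray_norm_le bq T_0; rewrite -/(hitting_point o beta r) nT.
  have : q * T <= q * t by rewrite ler_wpM2l ?(ltW Tt)//; lra.
  by rewrite /r; have := normr_ge0 (norm (beta t) + h + 2^-1); have := normr_ge0 T0; lra.
have [g [g0 g1 gi]] := geoX o (beta T).
have nTr : norm (beta T) = r by exact: nT.
rewrite nTr in g1 gi.
have bT : quasi_geodesic `[0, T] q Q beta.
  split=> //; first exact: interval_is_interval.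
    by apply: (continuous_subspaceW _ bc); apply: subset_itvl; rewrite bnd_simp.
  move=> u v; rewrite /= !in_itv/= => /andP[u0 _] /andP[v0 _].
  by apply: bqq; rewrite /= in_itv/= ?u0 ?v0.
have gb0 : (g @` `[0, r]) (beta 0) by exists 0; rewrite ?g0 ?b0//= in_itv/= lexx ltW.
have gbT : (g @` `[0, r]) (beta T) by exists r; rewrite ?g1//= in_itv/= lexx ltW.
have [+ _] := morse X delta q Q propX geoX hypX.
move=> /(_ `[0, r]%classic g 0 T beta (@interval_is_interval _ _) gi T_0 bT gb0 gbT (beta t)).
have bt : (beta @` `[0, T]) (beta t) by exists t => //=; rewrite in_itv/= t0.
move=> /(_ bt); rewrite /neighborhood /= -/h => nh.
(* The slack [2^-1] replaces attainment of the infimum defining the distance to the geodesic. *)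
have [|_ [s sr <-] ds] := @edist_inf_lt_mdist _ _ (g @` `[0, r]) (beta t) (h + 2^-1).
  by apply: le_lt_trans nh _; rewrite lte_fin ltrDl.
move: sr; rewrite /= in_itv/= => /andP[s0 sr].
have gs : norm (g s) = s.
  by rewrite -g0 gi ?sub0r ?normrN ?ger0_norm//= in_itv/= ?lexx ?s0// ltW.
have sle : s <= norm (beta t) + h + 2^-1.
  by rewrite -{1}gs; have := mdist_sub_le o (g s) (beta t); rewrite (metric_sym (g s)); lra.
exists s; split=> //; apply: le_lt_trans (metric_triangle _ (g s) _) _.
apply: ltr_leD => //; have [a0 _] := ga.
(* The endpoints have norm [r] and distance below [r], so their Gromov product exceeds
   [r / 2 >= s]. *)
apply: (geodesics_close hypX (ltW r0) (ltW r0) g0 a0 gi (geodesic_ray_isometric ga)) => //.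
rewrite g1 gromov_productE nTr (geodesic_ray_norm ga (ltW r0)).
have : 2 * s <= r.
  rewrite /r; have := ler_norm (norm (beta t) + h + 2^-1).
  by have := normr_ge0 T0; lra.
lra.
Qed.

End QuasiGeodesicRays.

(** * The sets [U_kappa] in terms of Gromov products *)

Section FellowRadius.
Context {R : realType} {X : metricType R} (o : X) (kappa : R -> R).
Context (delta : R) (H : R -> R -> R -> R).
Hypothesis propX : proper_space X.
Hypothesis geoX : geodesic_space X.
Hypothesis hypX : hyperbolic X delta.
Hypothesis subk : sublinear kappa.
Hypothesis morseH : morse_constant H.
Local Notation norm := (mdist o).
Implicit Types (a b : boundary o kappa) (alpha beta : R -> X) (r t : R).

Lemma sublinear_ge1 r : 0 <= r -> 1 <= kappa r.
Proof. by case: subk => + _ _ _; apply. Qed.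

Lemma sublinear_lt (M : R) : 0 < M -> exists2 R0, 0 <= R0 & forall r, R0 < r -> M * kappa r < r.
Proof.
move=> M0; case: subk => _ _ _ /cvgrPdist_lt /(_ M^-1).
rewrite invr_gt0 => /(_ M0)[T [_ HT]].
exists (Num.max 0 T); first by rewrite le_max lexx.
move=> r; rewrite gt_max => /andP[r0 Tr].
have := HT r Tr; rewrite sub0r normrN => /(le_lt_trans (ler_norm _)).
by rewrite ltr_pdivrMr// -ltr_pdivrMl ?invr_gt0// invrK.
Qed.

(** A point of [beta'] before radius [r] is near some [beta s] by the Morse lemma, with
    [s <= r + M <= 2 * r], where [alpha] and [beta] are still close. The total
    [H delta q Q + 2^-1 + 8 * delta] is at most [M], and [kappa >= 1]. *)
Lemma U_kappa_of_gromov_product alpha beta b r t :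
  geodesic_ray o alpha -> geodesic_ray o beta -> val b beta -> 0 < r -> 0 <= t ->
  2 * r <= gromov_product o (alpha t) (beta t) -> U_kappa delta H alpha r b.
Proof.
move=> ga gb bb r0 t0 rt q Q beta' bb' bq Mr _ [u /= ut <-].
move: ut; rewrite in_itv/= => /andP[u0 ut].
have kr := sublinear_ge1 (ltW r0).
set M := morse_bound delta H q Q in Mr *; set x := beta' u.
have M1 : 1 <= M.
  by case: bq => _ [_ q1 _ _ _]; rewrite /M /morse_bound !le_max q1.
have MH : 3 * H delta q Q + 30 * delta <= M by rewrite /M /morse_bound !le_max lexx !orbT.
have M24 : 24 * M < r.
  move: Mr; rewrite ltr_pdivlMr; last by rewrite mulr_gt0//; lra.
  by apply: le_lt_trans; rewrite mulrC ler_wpM2l//; lra.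
have xr : norm x <= r := norm_le_before_hitting bq (ltW r0) u0 ut.
have d0 := hyperbolic_ge0 o hypX.
have [s [s0 sx ds]] := quasi_geodesic_ray_near_geodesic propX geoX hypX morseH gb bq
  (boundary_equiv bb' bb) u0.
have h0 : H delta q Q + 2^-1 <= M by lra.
have sab : mdist (alpha s) (beta s) <= 4 * delta.
  by apply: (geodesic_rays_close hypX ga gb t0 s0); apply: le_trans rt; lra.
rewrite /kappa_neighborhood/=.
apply: (@edist_inf_le_mdist _ _ _ _ (alpha s)).
  by exists s => //=; rewrite in_itv/= s0.
have kx := sublinear_ge1 (mdist_ge0 o x).
apply: (@lt_le_trans _ _ M); last by rewrite ler_peMr//; lra.
apply: le_lt_trans (metric_triangle _ (beta s) _) _.
rewrite [X in _ + X]metric_sym.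
by move: ds; rewrite -/x; lra.
Qed.

Lemma morse_bound_ge1 q Q : 1 <= q -> 1 <= morse_bound delta H q Q.
Proof. by move=> q1; rewrite /morse_bound !le_max q1. Qed.

Lemma geodesic_ray_quasi_geodesic alpha : geodesic_ray o alpha ->
  quasi_geodesic_ray o 1 0 alpha.
Proof.
move=> [a0 ai]; split=> //; split=> //; first exact: interval_is_interval.
  by apply: lipschitz_within_continuous => s t s0 t0; rewrite ai.
by move=> s t s0 t0; rewrite invr1 !mul1r subr0 addr0 ai// !lexx.
Qed.

(** The test ray is [beta] itself, with constants 1 and 0. Beyond [R0] the allowed deviation is
    below [r / 24], so [beta r] lies within [r / 12] of [alpha r]; up to [R0] the threshold in
    [U_kappa] may exclude this test. *)
Lemma gromov_product_of_U_kappa : exists2 R0, 0 <= R0 &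
  forall alpha beta b r, geodesic_ray o alpha -> geodesic_ray o beta -> val b beta ->
    0 < r -> U_kappa delta H alpha r b ->
    r <= R0 \/ r <= 2 * gromov_product o (alpha r) (beta r).
Proof.
set M := morse_bound delta H 1 0; have M1 : 1 <= M := morse_bound_ge1 _ (lexx 1).
have [R0 R00 HR] := sublinear_lt (M := 24 * M) ltac:(lra).
exists R0 => // alpha beta b r ga gb bb r0 bU.
have [rR|Rr] := leP r R0; [by left|right].
have k1 := sublinear_ge1 (ltW r0).
have Mr : M < r / (24 * kappa r).
  by rewrite ltr_pdivlMr; [rewrite mulrCA mulrA HR|rewrite mulr_gt0//; lra].
have br : initial_part o beta r (beta r).
  by exists r => //=; rewrite in_itv/= (hitting_time_geodesic gb (ltW r0)) (ltW r0) lexx.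
have := bU 1 0 beta bb (geodesic_ray_quasi_geodesic gb) Mr (beta r) br.
rewrite /kappa_neighborhood /= (geodesic_ray_norm gb (ltW r0)) -/M => nM.
have [|_ [s s0 <-] ds] := @edist_inf_lt_mdist _ _ (ray_image alpha) (beta r) (r / 24).
  apply: le_lt_trans nM _; rewrite lte_fin ltr_pdivlMr//.
  by rewrite mulrC mulrA HR.
move: s0; rewrite /= in_itv/= andbT => s0.
have [_ ai] := ga.
have rs : `|r - s| < r / 24.
  apply: le_lt_trans ds; rewrite -{1}(geodesic_ray_norm gb (ltW r0)) -{1}(geodesic_ray_norm ga s0).
  exact: mdist_dist_le.
have asr : mdist (alpha s) (alpha r) = `|r - s|.
  by rewrite metric_sym ai//= in_itv/= ?s0 ?(ltW r0).
have := metric_triangle (beta r) (alpha s) (alpha r); rewrite asr metric_sym => ab.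
rewrite (gromov_product_rays ga gb (ltW r0)); lra.
Qed.

End FellowRadius.


(** * Gromov products of inequivalent geodesic rays *)

Section RayProduct.
Context {R : realType} {X : metricType R} (o : X) (delta : R).
Hypothesis hypX : hyperbolic X delta.
Implicit Types (alpha beta : R -> X) (s t : R).

Definition ray_product alpha beta : R :=
  sup [set gromov_product o (alpha t) (beta t) | t in [set t | 0 <= t]].

Lemma ray_productC alpha beta : ray_product alpha beta = ray_product beta alpha.
Proof.
by rewrite /ray_product; under eq_imagel do rewrite gromov_productC.
Qed.

(** Unbounded products would keep the rays [4 * delta]-close at every radius, hence equivalent. *)
Lemma ray_product_has_sup alpha beta : geodesic_ray o alpha -> geodesic_ray o beta ->
  ~ kappa_equiv o alpha beta ->
  has_sup [set gromov_product o (alpha t) (beta t) | t in [set t | 0 <= t]].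
Proof.
move=> ga gb nab; split.
  by exists (gromov_product o (alpha 0) (beta 0)), 0 => /=.
apply: contrapT => nub; apply: nab.
apply: (kappa_equiv_bounded (C := 4 * delta) ga gb) => s s0.
have [t [t0 st]] : exists t, 0 <= t /\ s <= gromov_product o (alpha t) (beta t).
  apply: contrapT => nt; apply: nub; exists s => _ [t /= t0 <-].
  by rewrite leNgt; apply/negP => /ltW st; apply: nt; exists t.
exact: (geodesic_rays_close hypX ga gb t0 s0 st).
Qed.

Lemma ray_product_ge alpha beta t : geodesic_ray o alpha -> geodesic_ray o beta ->
  ~ kappa_equiv o alpha beta -> 0 <= t ->
  gromov_product o (alpha t) (beta t) <= ray_product alpha beta.
Proof.
move=> ga gb nab t0; apply: sup_upper_bound; first exact: ray_product_has_sup.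
by exists t.
Qed.

Lemma ray_product_ge0 alpha beta : geodesic_ray o alpha -> geodesic_ray o beta ->
  ~ kappa_equiv o alpha beta -> 0 <= ray_product alpha beta.
Proof.
move=> ga gb nab; apply: le_trans (ray_product_ge ga gb nab (lexx 0)).
exact: gromov_product_ge0.
Qed.

Lemma ray_product_gt alpha beta s : geodesic_ray o alpha -> geodesic_ray o beta ->
  ~ kappa_equiv o alpha beta -> s < ray_product alpha beta ->
  exists2 t, 0 <= t & s < gromov_product o (alpha t) (beta t).
Proof.
move=> ga gb nab sP.
have [_ [t t0 <-] st] := sup_adherent (ltr0Sn R 0) (ray_product_has_sup ga gb nab).
have Ps : 0 < ray_product alpha beta - s by rewrite subr_gt0.
have [_ [t' t0' <-]] := sup_adherent Ps (ray_product_has_sup ga gb nab).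
by rewrite -/(ray_product alpha beta) opprB addrCA subrr addr0 => st'; exists t'.
Qed.

End RayProduct.

(** Without the floor the power equals [2 / r]; rounding the logarithm down gains at most a factor
    2. *)
Lemma dyadic_floor_bounds (R : realType) (r : R) : 0 < r ->
  2 / r <= (2 : R) ^ (- Num.floor (ln r / ln 2) + 1) <= 4 / r.
Proof.
move=> r0; have ln2 : 0 < ln (2 : R) by rewrite ln_gt0// ltr1n.
set l := ln r / ln 2; have lE : l * ln 2 = ln r by rewrite divfK// gt_eqF.
have /andP[fl lf] := floor_itv l.
rewrite -powR_intmul// /powR gt_eqF// intrD intrN.
rewrite intrD in lf.
have -> : 2 / r = expR ((1 - l) * ln 2).
  by rewrite mulrBl mul1r lE expRB !lnK ?posrE.
have -> : 4 / r = expR ((2 - l) * ln 2).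
  rewrite mulrBl lE expRB (lnK (_ : r \is Num.pos)) ?posrE//; congr (_ / _).
  rewrite expRM_natl lnK ?posrE//; ring.
by rewrite !ler_expR !ler_pM2r//; apply/andP; split; lra.
Qed.

(** * Comparison of [rho] with the Gromov product *)

Section RhoBounds.
Context {R : realType} {X : metricType R} (o : X) (kappa : R -> R).
Context (delta : R) (H : R -> R -> R -> R) (rep : boundary o kappa -> R -> X).
Hypothesis propX : proper_space X.
Hypothesis geoX : geodesic_space X.
Hypothesis hypX : hyperbolic X delta.
Hypothesis subk : sublinear kappa.
Hypothesis morseH : morse_constant H.
Hypothesis repP : geodesic_representatives rep.
Implicit Types (a b : boundary o kappa) (alpha beta : R -> X) (r t : R).

Definition boundary_product a b : R := ray_product o (rep a) (rep b).

Lemma representatives_distinct a b : a != b -> ~ kappa_equiv o (rep a) (rep b).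
Proof.
by move=> /eqP ab e; apply: ab; apply: boundary_eq (repP a).2 (repP b).2 e.
Qed.

Lemma boundary_product_ge0 a b : a != b -> 0 <= boundary_product a b.
Proof.
move=> ab; exact: (ray_product_ge0 hypX (repP a).1 (repP b).1 (representatives_distinct ab)).
Qed.

Lemma fellow_sup_bounds : exists2 R0, 0 <= R0 & forall alpha beta b,
  geodesic_ray o alpha -> geodesic_ray o beta -> val b beta -> ~ kappa_equiv o alpha beta ->
  ((ray_product o alpha beta / 4)%:E <= fellow_sup delta H alpha b
     <= (2 * ray_product o alpha beta + R0)%:E)%E.
Proof.
have [R0 R00 HR] := gromov_product_of_U_kappa o delta H subk.
exists R0 => // alpha beta b ga gb bb nab; have P0 := ray_product_ge0 hypX ga gb nab.
set P := ray_product o alpha beta in P0 *.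
apply/andP; split.
  (* For [P = 0] the maximum with 0 in [fellow_sup] gives the bound. Otherwise some product exceeds
     [P / 2], twice the radius [P / 4]. *)
  have [PE|Pgt] := leP P 0.
    by rewrite /fellow_sup le_max lee_fin; apply/orP; left; lra.
  have [t t0 tP] : exists2 t, 0 <= t & P / 2 < gromov_product o (alpha t) (beta t).
    by apply: (ray_product_gt hypX) => //; rewrite -/P; lra.
  rewrite /fellow_sup le_max; apply/orP; right.
  apply: ereal_sup_ubound; exists (P / 4) => //; split; first by lra.
  apply: (U_kappa_of_gromov_product propX geoX hypX subk morseH ga gb bb _ t0); first by lra.
  by apply: le_trans (ltW tP); lra.
rewrite /fellow_sup ge_max lee_fin; apply/andP; split; first by lra.
apply: ge_ereal_sup => _ [r [r0 rU] <-]; rewrite lee_fin.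
have [rR|rP] := HR alpha beta b r ga gb bb r0 rU; first by lra.
have := ray_product_ge hypX ga gb nab (ltW r0); rewrite -/P; lra.
Qed.

Lemma rho_bounds : exists2 c, 1 <= c & forall a b, a != b ->
  (c * (1 + boundary_product a b))^-1 <= rho delta H rep a b <= c * (1 + boundary_product a b)^-1.
Proof.
(* For [r >= 2] the upper bound [4 / r] needs [4 * (1 + P) <= 4 + 16 * r <= 18 * r]; for [r < 2] one
   has [1 + P < 9]. The term [R0] absorbs the additive constant in [r <= 2 * P + R0]. *)
have [R0 R00 HR] := fellow_sup_bounds; exists (18 + R0); first by lra.
move=> a b ab; set P := boundary_product a b.
have P0 : 0 <= P := boundary_product_ge0 ab.
have nab := representatives_distinct ab.
have nba : ~ kappa_equiv o (rep b) (rep a) by move=> /kappa_equiv_sym.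
have /andP[l1 u1] := HR _ _ a (repP b).1 (repP a).1 (repP a).2 nba.
have /andP[l2 u2] := HR _ _ b (repP a).1 (repP b).1 (repP b).2 nab.
rewrite ray_productC -/(boundary_product a b) -/P in l1 u1.
rewrite -/(boundary_product a b) -/P in l2 u2.
have [r [rE rl ru]] : exists r,
    [/\ fellow_radius delta H rep a b = r%:E, P / 4 <= r & r <= 2 * P + R0].
  have lf : ((P / 4)%:E <= fellow_radius delta H rep a b)%E.
    by rewrite /fellow_radius (negbTE ab) le_min l1 l2.
  have uf : (fellow_radius delta H rep a b <= (2 * P + R0)%:E)%E.
    by rewrite /fellow_radius (negbTE ab) ge_min u1.
  by case: (fellow_radius _ _ _ _ _) lf uf => [r| |]//; rewrite !lee_fin; exists r.
have cP : 0 < (18 + R0) * (1 + P) by rewrite mulr_gt0//; lra.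
rewrite /rho (negbTE ab) rE lte_fin /=.
have [r2|r2] := ltP r 2.
  apply/andP; split.
    rewrite invf_le1//; have := mulr_ge0 R00 P0; lra.
  by rewrite ler_pdivlMr; have := mulr_ge0 R00 P0; lra.
have r0 : 0 < r by lra.
have := dyadic_floor_bounds r0; set z := _ ^ _; clearbody z => /andP[d1 d2].
apply/andP; split; [apply: le_trans d1|apply: (le_trans d2)].
  rewrite ler_pdivlMr// ler_pdivrMl//; have := mulr_ge0 R00 P0; lra.
rewrite ler_pdivrMr//.
have -> : (18 + R0) / (1 + P) * r = (18 + R0) * r / (1 + P) by ring.
rewrite ler_pdivlMr; last lra.
have := mulr_ge0 R00 (ltW r0); lra.
Qed.

Lemma rho_powR_bounds theta : 0 < theta -> theta <= 1 ->
  exists2 c, 1 <= c & forall a b, a != b ->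
  c^-1 * floyd_tail theta (boundary_product a b) <= rho delta H rep a b `^ theta
    <= c * floyd_tail theta (boundary_product a b).
Proof.
move=> t0 t1; have [c c1 HR] := rho_bounds; exists c => // a b ab.
have /andP[l u] := HR a b ab; set P := boundary_product a b in l u *.
have P0 : 0 <= P := boundary_product_ge0 ab.
have P1 : 0 < 1 + P by lra.
have c0 : 0 < c by lra.
have cc : c `^ theta <= c by exact: ler1_powR.
have cc0 : 0 < c `^ theta by rewrite powR_gt0.
have invp (x : R) : 0 < x -> x^-1 `^ theta = (x `^ theta)^-1.
  by move=> x0; rewrite -(powR_inv1 (ltW x0)) -powRrM mulN1r powRN.
have tE : floyd_tail theta P = (1 + P)^-1 `^ theta by rewrite invp// /floyd_tail powRN.
have l0 : 0 <= (c * (1 + P))^-1 by rewrite invr_ge0 mulr_ge0 ?ltW.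
have r0 : 0 <= rho delta H rep a b by exact: le_trans l.
have iP : 0 <= (1 + P)^-1 by rewrite invr_ge0 ltW.
have tp : 0 <= floyd_tail theta P by rewrite ltW// floyd_tail_gt0.
apply/andP; split.
  apply: le_trans (ge0_ler_powR (ltW t0) l0 r0 l).
  have ic0 : 0 <= c^-1 by rewrite invr_ge0 ltW.
  rewrite invfM powRM// -tE ler_wpM2r//.
  by rewrite invp// lef_pV2 ?posrE.
have u0 : 0 <= c * (1 + P)^-1 by rewrite mulr_ge0// ltW.
apply: le_trans (ge0_ler_powR (ltW t0) r0 u0 u) _.
by rewrite powRM ?(ltW c0)// -tE ler_wpM2r.
Qed.

End RhoBounds.


(** * Limits of geodesics along an ultrafilter *)

Section LimitRay.
Context {R : realType} {X : metricType R} (o : X).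
Hypothesis propX : proper_space X.
Local Notation norm := (mdist o).
Implicit Types (U : set_system X) (t s M : R).

(** Compactness of the ball gives a cluster point, and for an ultrafilter a cluster point is a
    limit. *)
Lemma proper_ultra_cvg (U : set_system X) (UU : UltraFilter U) (f : X -> X) M :
  U [set x | norm (f x) <= M] -> exists p, forall e, 0 < e -> U [set x | mdist p (f x) < e].
Proof.
move=> UM; have [|p [_ pc]] := @propX o M (f @ U) _; first exact: UM.
exists p => e e0.
have [//|nU] := in_ultra_setVsetC [set x | mdist p (f x) < e] UU.
have [y [/= ye]] : ~` [set y | mdist p y < e] `&` [set y | mdist p y < e] !=set0.
  apply: pc; first exact: nU.
  by rewrite -(ballEmdist p e); exact: nbhsx_ballx.
by [].
Qed.

(** For fixed [t], almost every [x] has norm above [t], so [g x t] lies on the sphere of radius [t]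
    and has a limit; isometry passes to these pointwise limits. *)
Lemma limit_geodesic_ray (U : set_system X) (UU : UltraFilter U) (g : X -> R -> X) :
  (forall x, g x 0 = o /\ isometric_on `[0, norm x] (g x)) ->
  (forall M, U [set x | M < norm x]) ->
  exists2 alpha, geodesic_ray o alpha &
    forall t e, 0 <= t -> 0 < e -> U [set x | mdist (alpha t) (g x t) < e].
Proof.
move=> gP Uoo.
have UF : Filter U by exact: filter_filter.
have Un A : U A -> exists x, A x.
  by move=> UA; have [x Ax] := @filter_ex _ U _ A UA; exists x.
have /choice[alpha alphaP] : forall t, exists p, 0 <= t ->
    forall e, 0 < e -> U [set x | mdist p (g x t) < e].
  move=> t; have [t0|t0] := leP 0 t; last by exists o.
  have [|p pU] := @proper_ultra_cvg U UU (g ^~ t) t; last by exists p.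
  apply: filterS (Uoo t) => x /= tx; have [g0 gi] := gP x.
  by rewrite -{1}g0 gi ?sub0r ?normrN ?ger0_norm//= in_itv/= ?lexx ?mdist_ge0 ?t0 ?(ltW tx).
exists alpha; last by move=> t e t0 e0; exact: alphaP.
split.
  apply: mdist_positivity; apply/eqP; rewrite eq_le mdist_ge0 andbT.
  apply/ler_addgt0Pl => e e0; rewrite addr0; have [x /=] := Un _ (alphaP 0 (lexx 0) e e0).
  by have [-> _] := gP x => /ltW.
move=> s t; rewrite /= !in_itv/= !andbT => s0 t0.
apply/eqP; rewrite -subr_eq0 -normr_le0; apply/ler_addgt0Pl => e e0; rewrite addr0.
have e2 : 0 < e / 2 by rewrite divr_gt0.
have [x /= [[xs xt] [ns nt]]] := Un _ (filterI (filterI (alphaP s s0 _ e2) (alphaP t t0 _ e2))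
  (filterI (Uoo s) (Uoo t))).
have [_ gi] := gP x.
have gst : mdist (g x s) (g x t) = `|s - t|.
  by rewrite gi//= in_itv/= ?s0 ?t0 ltW.
rewrite ler_distl.
have := metric_triangle (alpha s) (g x s) (alpha t).
have := metric_triangle (g x s) (g x t) (alpha t).
have := metric_triangle (g x s) (alpha s) (g x t).
have := metric_triangle (alpha s) (alpha t) (g x t).
rewrite gst (metric_sym (g x s) (alpha s)) (metric_sym (g x t) (alpha t)).
by move=> h1 h2 h3 h4; apply/andP; split; lra.
Qed.

(** Within distance 1 of [p] only parameters up to [norm p + 1] occur, and that part of the image is
    compact. *)
Lemma geodesic_ray_closed (alpha : R -> X) : geodesic_ray o alpha ->
  closed (ray_image alpha).
Proof.
move=> ga p pc; pose D := norm p + 1.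
have Kc : compact (alpha @` `[0, D]).
  apply: continuous_compact; last exact: segment_compact.
  apply: lipschitz_within_continuous => s t sD tD.
  by rewrite (geodesic_ray_isometric ga sD tD).
have /(compact_closed (@metric_hausdorff _ X)) Kcl := Kc.
suff [s sD sp] : (alpha @` `[0, D]) p.
  by exists s => //; move: sD; rewrite /= !in_itv/= => /andP[->].
apply: Kcl => B Bp.
have [_ [[s s0 <-] [Bs /=]]] := pc (B `&` ball p 1) (filterI Bp (nbhsx_ballx p 1 ltr01)).
rewrite ballEmdist/= => ps; exists (alpha s); split=> //; exists s => //.
move: s0; rewrite /= !in_itv/= andbT => s0; rewrite s0/= /D.
rewrite -{1}(geodesic_ray_norm ga s0).
by have := mdist_sub_le o (alpha s) p; rewrite (metric_sym (alpha s)); lra.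
Qed.

Lemma geodesic_ray_kappa_ray kappa delta (H : R -> R -> R -> R) (alpha : R -> X) :
  geodesic_space X -> hyperbolic X delta -> sublinear kappa -> morse_constant H ->
  geodesic_ray o alpha -> kappa_ray o kappa alpha.
Proof.
move=> geoX hypX subk morseH ga; split.
  by exists 1, 0; exact: geodesic_ray_quasi_geodesic.
split; first exact: geodesic_ray_closed.
(* The sum [q + Q] makes the function proper, whatever the growth of [H]; the absolute value makes
   it nonnegative. *)
exists (fun q Q => q + Q + `|H delta q Q|); split.
- by move=> q Q q1 Q0; rewrite !addr_ge0//; lra.
- move=> B; exists B => q Q q1 Q0; have := normr_ge0 (H delta q Q) => h hB; split; lra.
- move=> q Q a b beta ab bq ba bb x bx.
  have [a0 ai] := ga.
  have [+ _] := morseH X delta q Q propX geoX hypX.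
  move=> /(_ `[0, +oo[%classic alpha a b beta (@interval_is_interval _ _) ai ab bq ba bb x bx).
  rewrite /neighborhood /kappa_neighborhood/= => /le_trans; apply; rewrite lee_fin.
  have k1 := sublinear_ge1 subk (mdist_ge0 o x).
  have [_ q1 Q0 _ _] := bq.
  apply: (@le_trans _ _ (q + Q + `|H delta q Q|)); first by have := ler_norm (H delta q Q); lra.
  by rewrite ler_peMr// !addr_ge0//; lra.
Qed.

End LimitRay.

(** * Rays in the completion and the boundary map *)

Section FloydBoundary.
Context {R : realType} {X : metricType R} (o : X) (delta : R) (kappa : R -> R).
Context (H : R -> R -> R -> R) (theta : R) (F : metricType R) (i : X -> F).
Hypothesis propX : proper_space X.
Hypothesis geoX : geodesic_space X.
Hypothesis hypX : hyperbolic X delta.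
Hypothesis subk : sublinear kappa.
Hypothesis morseH : morse_constant H.
Hypothesis theta_gt0 : 0 < theta.
Hypothesis theta_le1 : theta <= 1.
Hypothesis complF : metric_completion (floyd_metric o theta) i.
Local Notation norm := (mdist o).
Local Notation sigma := (floyd_metric o theta).
Local Notation tail := (floyd_tail theta).
Implicit Types (alpha beta : R -> X) (s t : R) (l : F) (a b : boundary o kappa).

Lemma floyd_metricE x y : sigma x y = mdist (i x) (i y).
Proof. by case: complF => ->. Qed.

Lemma le_of_tail_bound (u v C : R) : 0 <= C ->
  (exists T, forall t, T <= t -> 0 <= t -> u <= v + C * tail t) -> u <= v.
Proof.
move=> C0 [T HT]; apply/ler_addgt0Pl => e e0.
have e1 : 0 < e / (C + 1) by rewrite divr_gt0//; lra.
have [T' HT'] := floyd_tail_cvg0 theta_gt0 e1.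
pose t := Num.max 0 (Num.max T T').
have [t0 tT tT'] : [/\ 0 <= t, T <= t & T' <= t] by rewrite !le_max !lexx !orbT.
apply: le_trans (HT t tT t0) _; rewrite addrC lerD2r.
have := HT' t tT' t0; rewrite ltr_pdivlMr; last lra.
have := floyd_tail_gt0 theta t0; lra.
Qed.

Lemma isometric_completion_le (g : R -> X) D s t : g 0 = o -> isometric_on `[0, D] g ->
  0 <= s -> s <= t -> t <= D -> mdist (i (g s)) (i (g t)) <= 4 / theta * tail s.
Proof.
move=> g0 gi s0 st tD; rewrite -floyd_metricE.
apply: le_trans (floyd_metric_radial theta_gt0 theta_le1 _ _ g0 gi s0 st tD) _.
- by move=> x y z; rewrite !floyd_metricE; exact: metric_triangle.
- by move=> x; rewrite floyd_metricE mdistxx.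
- rewrite ler_wpM2l ?divr_ge0 ?(ltW theta_gt0)// gerBl ltW// floyd_tail_gt0//.
  exact: le_trans st.
Qed.

Lemma ray_completion_le alpha s t : geodesic_ray o alpha -> 0 <= s -> s <= t ->
  mdist (i (alpha s)) (i (alpha t)) <= 4 / theta * tail s.
Proof.
move=> ga s0 st; have [a0 _] := ga.
exact: isometric_completion_le a0 (geodesic_ray_isometric (D := t) ga) s0 st (lexx t).
Qed.

Lemma ray_completion_cvg alpha : geodesic_ray o alpha ->
  exists l, i (alpha t) @[t --> +oo] --> l.
Proof.
move=> ga; case: complF => _ _; apply.
apply: cauchy_exP => e e0.
have e1 : 0 < e / (4 / theta) by rewrite !divr_gt0.
have [T HT] := floyd_tail_cvg0 theta_gt0 e1.
pose s := Num.max 0 T.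
have [s0 sT] : 0 <= s /\ T <= s by rewrite !le_max !lexx !orbT.
exists (i (alpha s)).
change (\forall t \near +oo, ball (i (alpha s)) e (i (alpha t))).
near=> t; rewrite ballEmdist/=.
apply: (@le_lt_trans _ _ (4 / theta * tail s)).
  apply: ray_completion_le => //; near: t; apply: nbhs_pinfty_ge; exact: num_real.
by rewrite mulrC -ltr_pdivlMr ?divr_gt0// HT.
Unshelve. all: by end_near. Qed.

Lemma ray_completion_limit_le alpha l s : geodesic_ray o alpha ->
  i (alpha t) @[t --> +oo] --> l -> 0 <= s -> mdist (i (alpha s)) l <= 4 / theta * tail s.
Proof.
move=> ga /metricType_numDomainType.cvgr_dist_lt al s0; apply/ler_addgt0Pl => e e0.
near +oo_R => t.
apply: le_trans (metric_triangle _ (i (alpha t)) _) _; rewrite addrC.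
apply: lerD.
  rewrite metric_sym ltW//; near: t; exact: al.
apply: ray_completion_le => //; near: t; apply: nbhs_pinfty_ge; exact: num_real.
Unshelve. all: by end_near. Qed.

Lemma ray_completion_cvg_of_le alpha l (C : R) : 0 <= C ->
  (forall s, 0 <= s -> mdist (i (alpha s)) l <= C * tail s) -> i (alpha t) @[t --> +oo] --> l.
Proof.
move=> C0 al; apply/metricType_numDomainType.cvgrPdist_lt => e e0.
have e1 : 0 < e / (C + 1) by rewrite divr_gt0//; lra.
have [T HT] := floyd_tail_cvg0 theta_gt0 e1.
near=> t; have t0 : 0 <= t by near: t; apply: nbhs_pinfty_ge; exact: num_real.
rewrite metric_sym; apply: le_lt_trans (al t t0) _.
have Tt : T <= t by near: t; apply: nbhs_pinfty_ge; exact: num_real.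
have := HT t Tt t0; rewrite ltr_pdivlMr; last lra.
have := floyd_tail_gt0 theta t0; lra.
Unshelve. all: by end_near. Qed.

(** The two radial ends beyond [s] cost [4 / theta * tail s] each; the rest of the constant pays for
    the jump of length at most [4 * delta] at radius [s]. *)
Lemma rays_completion_dist_le alpha beta l l' s : geodesic_ray o alpha -> geodesic_ray o beta ->
  i (alpha t) @[t --> +oo] --> l -> i (beta t) @[t --> +oo] --> l' ->
  0 <= s -> mdist (alpha s) (beta s) <= 4 * delta ->
  mdist l l' <= (8 / theta + 4 * delta * (1 + 4 * delta)) * tail s.
Proof.
move=> ga gb al bl s0 ds; have d0 := hyperbolic_ge0 o hypX.
have h1 := ray_completion_limit_le ga al s0.
have h2 := ray_completion_limit_le gb bl s0.
have h3 : mdist (i (alpha s)) (i (beta s)) <= 4 * delta * (1 + 4 * delta) * tail s.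
  rewrite -floyd_metricE.
  apply: le_trans (floyd_metric_le_mdist_tail o theta_gt0 theta_le1 _ _ geoX) _.
  rewrite (geodesic_ray_norm ga s0) mulrA ler_wpM2r//; first exact: ltW (floyd_tail_gt0 _ s0).
  by rewrite ler_pM ?mdist_ge0 ?addr_ge0 ?mdist_ge0// lerD2l.
have := metric_triangle l (i (alpha s)) l'; have := metric_triangle (i (alpha s)) (i (beta s)) l'.
rewrite (metric_sym l (i (alpha s))); move: h1 h2 h3.
have -> : 8 / theta = 4 / theta + 4 / theta by field; rewrite gt_eqF.
set k := 4 / theta; set m := 4 * delta * _; lra.
Qed.

(** The map picks its limit along an unspecified geodesic of the class. Two geodesics of one class
    stay [4 * delta]-close forever, so the distance of their limits is bounded by a multiple of
    [tail t] for every [t]. *)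
Lemma floyd_map_cvg a alpha : geodesic_ray o alpha -> val a alpha ->
  i (alpha t) @[t --> +oo] --> floyd_map i a.
Proof.
move=> ga aa; have [l al] := ray_completion_cvg ga.
have [beta [gb ab] bl] : exists2 beta, geodesic_ray o beta /\ val a beta &
    i (beta t) @[t --> +oo] --> floyd_map i a.
  rewrite /floyd_map.
  apply: (@xgetPex _ (i o) [set l | exists2 alpha, geodesic_ray o alpha /\ val a alpha &
                        i (alpha t) @[t --> +oo] --> l]).
  by exists l; exists alpha.
suff <- : l = floyd_map i a by [].
apply: mdist_positivity; apply/eqP; rewrite eq_le mdist_ge0 andbT.
have d0 := hyperbolic_ge0 o hypX.
apply: (@le_of_tail_bound _ _ (8 / theta + 4 * delta * (1 + 4 * delta))).
  by rewrite addr_ge0 ?divr_ge0 ?mulr_ge0 ?(ltW theta_gt0)//; lra.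
exists 0 => t t0 _; rewrite add0r.
apply: (rays_completion_dist_le ga gb al bl t0).
exact: (kappa_equiv_close hypX ga gb (boundary_equiv aa ab) t0).
Qed.

(** If the limit were [i x], the lower bound by differences of tails would bound [tail (norm x)] by
    a multiple of [tail t] for every [t]. *)
Lemma floyd_map_boundary a alpha : geodesic_ray o alpha -> val a alpha ->
  floyd_boundary i (floyd_map i a).
Proof.
move=> ga aa [x _ xl].
have al := floyd_map_cvg ga aa; rewrite -xl in al.
suff : tail (norm x) <= 0 by rewrite leNgt floyd_tail_gt0// mdist_ge0.
apply: (@le_of_tail_bound _ _ (1 + 16 * (4 / theta))).
  by rewrite addr_ge0// mulr_ge0// divr_ge0// ltW.
exists 0 => t t0 _; rewrite add0r.
have := floyd_metric_ge_tail_sub o theta_gt0 theta_le1 geoX (alpha t) x.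
rewrite (geodesic_ray_norm ga t0) floyd_metricE.
have := ray_completion_limit_le ga al t0.
set k := 4 / theta; lra.
Qed.

Lemma floyd_map_surj l : floyd_boundary i l -> exists a, floyd_map i a = l.
Proof.
move=> ln; case: (complF) => _ dF _.
have dense_ball e : 0 < e -> exists x, mdist l (i x) < e.
  move=> e0; have [||y [yb [x _ xy]]] := dF (interior (ball l e)).
  - by exists l; exact: nbhsx_ballx.
  - exact: open_interior.
  - by exists x; move/interior_subset: yb; rewrite ballEmdist xy.
(* This is the neighbourhood filter of [l] pulled back to [X]; density of the range makes it
   proper. *)
pose G := filter_from [set e : R | 0 < e] (fun e => [set x | mdist l (i x) < e]).
have GP : ProperFilter G.
  apply: filter_from_proper; last by move=> e /dense_ball[x]; exists x.
  apply: filter_from_filter; first by exists 1 => /=.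
  move=> e e' /= e0 e0'; exists (Num.min e e') => /=; first by rewrite lt_min e0.
  by move=> x /=; rewrite lt_min => /andP[].
have [U [UU GU]] := ultraFilterLemma GP.
have Ul e : 0 < e -> U [set x | mdist l (i x) < e] by move=> e0; apply: GU; exists e.
have UF : Filter U by exact: filter_filter.
have Un A : U A -> exists x, A x.
  by move=> UA; have [x Ax] := @filter_ex _ U _ A UA; exists x.
(* Otherwise the ultrafilter lives on a ball and converges to some [p] in [X], and [sigma <= mdist]
   then forces [i p = l]. *)
have Uoo M : U [set x | M < norm x].
  have [//|UM] := in_ultra_setVsetC [set x | M < norm x] UU.
  have [|p pU] := proper_ultra_cvg propX UU (f := id) (o := o) (M := M).
    by apply: filterS UM => x /= /negP; rewrite -leNgt.
  exfalso; apply: ln; exists p => //; apply: mdist_positivity.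
  apply/eqP; rewrite eq_le mdist_ge0 andbT; apply/ler_addgt0Pl => e e0; rewrite addr0.
  have e2 : 0 < e / 2 by rewrite divr_gt0.
  have [x /= [px lx]] := Un _ (filterI (pU _ e2) (Ul _ e2)).
  have := metric_triangle (i p) (i x) l; rewrite (metric_sym (i x) l) -floyd_metricE.
  have := floyd_metric_le_mdist o theta_gt0 p x geoX; lra.
have /choice[g gP] : forall x, exists g : R -> X,
    [/\ g 0 = o, g (norm x) = x & isometric_on `[0, norm x] g] by move=> x; exact: geoX.
have [|alpha ga aU] := limit_geodesic_ray propX UU (g := g) _ Uoo.
  by move=> x; have [] := gP x.
have [a aa] := boundary_of_ray (geodesic_ray_kappa_ray propX geoX hypX subk morseH ga).
exists a; apply: (@cvg_unique _ (@metric_hausdorff _ F) (i (alpha t) @[t --> +oo])).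
  exact: floyd_map_cvg.
have C0 : 0 <= 4 / theta by rewrite divr_ge0 ?(ltW theta_gt0).
(* From [alpha s] the comparison goes to [g x s], radially out to [x], and on to [l]; for almost
   every [x] the first and last legs are as short as desired. *)
apply: (ray_completion_cvg_of_le C0) => s s0; apply/ler_addgt0Pl => e e0.
have e2 : 0 < e / 2 by rewrite divr_gt0.
have [x /= [[ax lx] sx]] := Un _ (filterI (filterI (aU s _ s0 e2) (Ul _ e2)) (Uoo s)).
have [g0 gx gi] := gP x.
have h1 := isometric_completion_le g0 gi s0 (ltW sx) (lexx _); rewrite gx in h1.
have h2 := floyd_metric_le_mdist o theta_gt0 (alpha s) (g x s) geoX.
rewrite floyd_metricE in h2.
have := metric_triangle (i (alpha s)) (i (g x s)) l.
have := metric_triangle (i (g x s)) (i x) l; rewrite (metric_sym (i x) l).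
move: h1; set k := 4 / theta * tail s; lra.
Qed.

(** * Distances of boundary points in the completion *)

Section BiLipschitz.
Context (rep : boundary o kappa -> R -> X).
Hypothesis repP : geodesic_representatives rep.

Lemma floyd_map_dist_le : exists2 c, 0 < c & forall a b, a != b ->
  mdist (floyd_map i a) (floyd_map i b) <= c * tail (boundary_product rep a b).
Proof.
have d0 := hyperbolic_ge0 o hypX.
set C := 8 / theta + 4 * delta * (1 + 4 * delta).
have C0 : 0 < C.
  by rewrite ltr_wpDr ?divr_gt0// mulr_ge0//; lra.
exists (C * 2) => [|a b ab]; first by rewrite mulr_gt0.
have [ga aa] := repP a; have [gb bb] := repP b.
have nab := representatives_distinct repP ab.
have P0 := boundary_product_ge0 hypX repP ab.
set P := boundary_product rep a b in P0 *.
have P20 : 0 <= P / 2 by rewrite divr_ge0.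
have [t t0 tP] : exists2 t, 0 <= t & P / 2 <= gromov_product o (rep a t) (rep b t).
  have [PE|PN] := leP P 0.
    by exists 0 => //; apply: le_trans (gromov_product_ge0 _ _ _); lra.
  have [|t t0 tP] := ray_product_gt hypX ga gb nab (s := P / 2); last by exists t => //; exact: ltW.
  by rewrite -/(boundary_product rep a b) -/P; lra.
have ds := geodesic_rays_close hypX ga gb t0 P20 tP.
apply: le_trans (rays_completion_dist_le ga gb (floyd_map_cvg ga aa)
  (floyd_map_cvg gb bb) P20 ds) _.
rewrite -/C -mulrA ler_pM2l//.
by apply: floyd_tail_scale => //; lra.
Qed.

Lemma floyd_map_dist_ge : exists2 c, 0 < c & forall a b, a != b ->
  c * tail (boundary_product rep a b) <= mdist (floyd_map i a) (floyd_map i b).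
Proof.
have [c c0 HC] := floyd_metric_ge_gromov_product o theta_gt0 theta_le1 hypX geoX.
exists (c / 16) => [|a b ab]; first by rewrite divr_gt0.
have [ga aa] := repP a; have [gb bb] := repP b.
have nab := representatives_distinct repP ab.
have P0 := boundary_product_ge0 hypX repP ab.
set P := boundary_product rep a b in P0 *.
have k0 : 0 <= 4 / theta by rewrite divr_ge0 ?(ltW theta_gt0).
(* The two radial ends give [4 / theta] each, and 1 covers the subtracted [tail t / 16]. *)
apply: (@le_of_tail_bound _ _ (4 / theta + 4 / theta + 1)); first by lra.
(* For [t >= P + 1] the points at radius [t] are at distance at least [2 * (t - P) >= 2], enough for
   the lower bound. *)
exists (P + 1) => t Pt t0.
have gP : gromov_product o (rep a t) (rep b t) <= P := ray_product_ge hypX ga gb nab t0.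
have d1 : 1 <= mdist (rep a t) (rep b t).
  by move: gP; rewrite (gromov_product_rays ga gb t0); lra.
have := HC _ _ d1; rewrite (geodesic_ray_norm ga t0) floyd_metricE => h.
have h1 := ray_completion_limit_le ga (floyd_map_cvg ga aa) t0.
have h2 := ray_completion_limit_le gb (floyd_map_cvg gb bb) t0.
have := metric_triangle (i (rep a t)) (floyd_map i a) (i (rep b t)).
have := metric_triangle (floyd_map i a) (floyd_map i b) (i (rep b t)).
rewrite (metric_sym (floyd_map i b)).
have tP : c * tail P <= c * tail (gromov_product o (rep a t) (rep b t)).
  by rewrite ler_pM2l//; apply: floyd_tail_anti => //; exact: gromov_product_ge0.
have tt := floyd_tail_gt0 theta t0.
move: h h1 h2 k0; set k := 4 / theta; lra.
Qed.

End BiLipschitz.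

End FloydBoundary.

(** * Assembly of the bi-Lipschitz bounds and bijectivity *)

Theorem corollary3p6 (R : realType) (X : metricType R) (o : X) (delta : R)
    (kappa : R -> R) (H : R -> R -> R -> R)
    (rep : boundary o kappa -> R -> X) (theta : R)
    (dlog : boundary o kappa -> boundary o kappa -> R)
    (F : metricType R) (i : X -> F) :
  proper_space X -> geodesic_space X -> hyperbolic X delta ->
  sublinear kappa -> morse_constant H -> geodesic_representatives rep ->
  admissible theta -> log_metric delta H rep theta dlog ->
  metric_completion (floyd_metric o theta) i ->
  [/\ forall (a : boundary o kappa) (alpha : R -> X),
        geodesic_ray o alpha -> val a alpha ->
        i (alpha t) @[t --> +oo] --> floyd_map i a,
      set_bij [set: boundary o kappa] (floyd_boundary i)
        (fun a : boundary o kappa => floyd_map i a) &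
      exists2 c : R, 1 <= c &
        forall a b : boundary o kappa,
          c^-1 * dlog a b <= mdist (floyd_map i a) (floyd_map i b)
            <= c * dlog a b].
Proof.
move=> propX geoX hypX subk morseH repP /andP[t0 t6] [[_ dlog0 _ _] [c0 c01 Hd]] complF.
have t1 : theta <= 1 by apply: (le_trans t6); rewrite invf_le1// ler1n.
have [c1 c11 H1] := rho_powR_bounds propX geoX hypX subk morseH repP t0 t1.
have [c2 c20 H2] := floyd_map_dist_le geoX hypX t0 t1 complF repP.
have [c3 c30 H3] := floyd_map_dist_ge geoX hypX t0 t1 complF repP.
have bilip : exists2 c : R, 1 <= c & forall a b : boundary o kappa,
    c^-1 * dlog a b <= mdist (floyd_map i a) (floyd_map i b) <= c * dlog a b.
  have c010 : 0 < c0 * c1 by rewrite mulr_gt0//; lra.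
  (* Here [c0 * c1] compares [dlog] with the tail, [c2] and [c3] compare the Floyd metric with it;
     the sum dominates both products and is at least 1. *)
  exists (1 + c0 * c1 * c2 + c0 * c1 / c3).
    rewrite -addrA lerDl addr_ge0//.
      by rewrite mulr_ge0 ?(ltW c20) ?(ltW c010).
    by rewrite divr_ge0 ?(ltW c30) ?(ltW c010).
  move=> a b; have [->|ab] := eqVneq a b.
    by rewrite (dlog0 b b).2// mdistxx !mulr0 lexx.
  have /andP[l1 u1] := H1 a b ab; have /andP[l0 u0] := Hd a b.
  have m2 := H2 a b ab; have m3 := H3 a b ab.
  set T := floyd_tail _ _ in l1 u1 m2 m3; set r := rho _ _ _ _ _ `^ _ in l1 u1 l0 u0.
  set d := dlog a b in l0 u0 *; set m := mdist _ _ in m2 m3 *.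
  have d0 : 0 <= d by apply: le_trans l0; rewrite mulr_ge0 ?powR_ge0// invr_ge0; lra.
  have m0 : 0 <= m := mdist_ge0 _ _.
  have Td : T <= c0 * c1 * d.
    move: l1 l0; rewrite !ler_pdivrMl; [|lra|lra] => l1 l0.
    apply: (le_trans l1); rewrite -mulrA mulrCA ler_pM2l//; lra.
  have dT : d <= c0 * c1 * T by apply: (le_trans u0); rewrite -mulrA ler_pM2l//; lra.
  have q0 : 0 <= c0 * c1 / c3 by rewrite divr_ge0 ?(ltW c30) ?(ltW c010).
  have q1 : 0 <= c0 * c1 * c2 by rewrite mulr_ge0 ?(ltW c20) ?(ltW c010).
  apply/andP; split.
    rewrite ler_pdivrMl; last lra.
    apply: (@le_trans _ _ (c0 * c1 / c3 * m)); last by rewrite ler_wpM2r//; lra.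
    have -> : c0 * c1 / c3 * m = c0 * c1 * (m / c3) by ring.
    by apply: (le_trans dT); rewrite ler_pM2l// ler_pdivlMr// mulrC.
  apply: (@le_trans _ _ (c0 * c1 * c2 * d)); last by rewrite ler_wpM2r//; lra.
  have -> : c0 * c1 * c2 * d = c2 * (c0 * c1 * d) by ring.
  by apply: (le_trans m2); rewrite ler_pM2l.
split=> //.
- by move=> a alpha; exact: (floyd_map_cvg geoX hypX t0 t1 complF).
- split.
  + move=> a _; have [ga aa] := repP a.
    exact: (floyd_map_boundary geoX hypX t0 t1 complF ga aa).
  (* Injectivity comes from the lower Lipschitz bound: equal images force [dlog a b = 0]. *)
  + move=> a b _ _ ab; apply/(dlog0 a b).1.
    have [c c1' /(_ a b)/andP[+ _]] := bilip; rewrite ab mdistxx.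
    rewrite ler_pdivrMl ?mulr0; last lra.
    have /andP[l0 _] := Hd a b; move=> d_le; apply/eqP; rewrite eq_le d_le/=.
    by apply: le_trans l0; rewrite mulr_ge0 ?powR_ge0// invr_ge0; lra.
  + move=> l ln.
    have [a al] := floyd_map_surj propX geoX hypX subk morseH t0 t1 complF ln.
    by exists a.
Qed.
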